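(* (i) Every regular $(LM)$-space is a quasi-$(DF)$-space. In particular, every infinite-dimensional metrizable non-normable locally convex space is a quasi-$(DF)$-space which is not a $(DF)$-space. (ii) The strong dual $E'_\beta$ of a regular $(LM)$-space $E$ is a quasi-$(DF)$-space. (iii) Countable locally convex direct sums of quasi-$(DF)$-spaces are quasi-$(DF)$-spaces. (iv) Every subspace of a quasi-$(DF)$-space is a quasi-$(DF)$-space. (v) Every countable product of quasi-$(DF)$-spaces is a quasi-$(DF)$-space. (vi) Every precompact subset of a quasi-$(DF)$-space is metrizable.
   Context: Order $\mathbb{N}^{\mathbb{N}}$ pointwise. A resolution in a set $\Omega$ is a family $\{A_\alpha:\alpha\in\mathbb{N}^{\mathbb{N}}\}$ covering $\Omega$ with $A_\alpha\subseteq A_\beta$ whenever $\alpha\le\beta$. A locally convex space $E$ has a fundamental bounded resolution if it has a resolution of bounded sets such that every bounded subset of $E$ lies in some member. $E$ belongs to the class $\mathfrak{G}$ if there is a resolution $\{A_\alpha\}$ of the weak* dual $(E',\sigma(E',E))$ such that every sequence contained in any $A_\alpha$ is equicontinuous. $E$ is a quasi-$(DF)$-space if it has a fundamental bounded resolution and belongs to the class $\mathfrak{G}$. $E$ is a $(DF)$-space if it has a fundamental sequence of bounded sets (every bounded set lies in one of them) and is $\aleph_0$-quasibarrelled (every strongly bounded subset of $E'$ which is a countable union of equicontinuous sets is equicontinuous). An $(LM)$-space is the locally convex inductive limit of an increasing sequence $(E_n,\tau_n)$ of metrizable locally convex spaces with $E=\bigcup_nE_n$ and $\tau_{n+1}|_{E_n}\le\tau_n$;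 it is regular if every bounded subset of $E$ is contained and bounded in some $E_n$. $E'_\beta=(E',\beta(E',E))$ is the strong dual. *)

(* Defs.v *)
From HB Require Import structures.
From mathcomp Require Import all_boot all_order all_algebra.
From mathcomp Require Import all_classical all_reals.
Set Implicit Arguments. Unset Strict Implicit. Unset Printing Implicit Defensive.
Import Order.TTheory GRing.Theory Num.Theory.
Local Open Scope ring_scope.
Local Open Scope classical_set_scope.

Section DProd.
Variables (R : ringType) (I : Type) (V : I -> lmodType R).
Definition dprod := forall i, V i.
Definition dp_zero : dprod := fun i => 0.
Definition dp_add (x y : dprod) : dprod := fun i => x i + y i.
Definition dp_opp (x : dprod) : dprod := fun i => - x i.
Definition dp_scale (a : R) (x : dprod) : dprod := fun i => a *: x i.
Let fe (x y : dprod) : (forall i, x i = y i) -> x = y :=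
  fun h => boolp.functional_extensionality_dep h.
Lemma dp_addA : associative dp_add.
Proof. by move=> x y z; apply: fe => i; rewrite /dp_add addrA. Qed.
Lemma dp_addC : commutative dp_add.
Proof. by move=> x y; apply: fe => i; rewrite /dp_add addrC. Qed.
Lemma dp_add0 : left_id dp_zero dp_add.
Proof. by move=> x; apply: fe => i; rewrite /dp_add /dp_zero add0r. Qed.
Lemma dp_addN : left_inverse dp_zero dp_opp dp_add.
Proof. by move=> x; apply: fe => i; rewrite /dp_add /dp_opp addNr. Qed.
HB.instance Definition _ := isPointed.Build dprod dp_zero.
HB.instance Definition _ := boolp.gen_eqMixin dprod.
HB.instance Definition _ := boolp.gen_choiceMixin dprod.
HB.instance Definition _ :=
  GRing.isZmodule.Build dprod dp_addA dp_addC dp_add0 dp_addN.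
Lemma dp_scaleA a b (x : dprod) : dp_scale a (dp_scale b x) = dp_scale (a * b) x.
Proof. by apply: fe => i; rewrite /dp_scale scalerA. Qed.
Lemma dp_scale1 : left_id 1 dp_scale.
Proof. by move=> x; apply: fe => i; rewrite /dp_scale scale1r. Qed.
Lemma dp_scaleDr : right_distributive dp_scale (@dp_add).
Proof. by move=> a x y; apply: fe => i; rewrite /dp_scale /dp_add scalerDr. Qed.
Lemma dp_scaleDl (x : dprod) : {morph dp_scale^~ x : a b / a + b >-> dp_add a b}.
Proof. by move=> a b; apply: fe => i; rewrite /dp_scale /dp_add scalerDl. Qed.
HB.instance Definition _ :=
  GRing.Zmodule_isLmodule.Build R dprod dp_scaleA dp_scale1 dp_scaleDr dp_scaleDl.
End DProd.

(* A space is a triple (V, S, P): V an ambient real vector space, S a linear *)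
(* subspace of V (the points of the space), P a family of seminorms on S     *)
(* (values outside S are irrelevant).  The topology is the one generated by *)
(* P.                                                                        *)
Section LCS.
Variables (R : realType) (V : lmodType R).
Implicit Types (S B : set V) (P : set (V -> R)) (p q : V -> R).

Definition linear_subspace S :=
  S 0 /\ (forall x y, S x -> S y -> S (x + y)) /\
  (forall (a : R) x, S x -> S (a *: x)).

Definition seminorm_on S q :=
  (forall x, S x -> 0 <= q x) /\
  (forall x y, S x -> S y -> q (x + y) <= q x + q y) /\
  (forall (a : R) x, S x -> q (a *: x) = `|a| * q x).

(* q is continuous for the topology generated by P on S *)
Definition cont_sn S P q :=
  exists (F : seq (V -> R)) (C : R),
    (forall p, p \in F -> P p) /\
    forall x, S x -> q x <= C * \sum_(p <- F) p x.

Definition lcs S P :=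
  linear_subspace S /\ (forall p, P p -> seminorm_on S p) /\
  (forall x, S x -> x <> 0 -> exists2 p, P p & p x <> 0).

Definition bounded S P B :=
  B `<=` S /\ forall p, P p -> exists M : R, forall x, B x -> p x <= M.

(* continuous linear functionals on S, normalized to vanish outside S *)
Definition dual S P : set (V -> R) := [set f |
  (forall x, ~ S x -> f x = 0) /\
  (forall (a : R) x y, S x -> S y -> f (a *: x + y) = a * f x + f y) /\
  cont_sn S P (fun x => `|f x|)].

Definition equicontinuous_set S P (H : set (V -> R)) :=
  exists (F : seq (V -> R)) (C : R),
    (forall p, p \in F -> P p) /\
    forall f x, H f -> S x -> `|f x| <= C * \sum_(p <- F) p x.

Definition nn_le (a b : nat -> nat) := forall n, (a n <= b n)%N.

Definition fundamental_bounded_resolution S P :=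
  exists A : (nat -> nat) -> set V,
    (forall a, bounded S P (A a)) /\
    (forall a b, nn_le a b -> A a `<=` A b) /\
    (forall x, S x -> exists a, A a x) /\
    (forall B, bounded S P B -> exists a, B `<=` A a).

Definition class_G S P :=
  exists A : (nat -> nat) -> set (V -> R),
    (forall a, A a `<=` dual S P) /\
    (forall a b, nn_le a b -> A a `<=` A b) /\
    (forall f, dual S P f -> exists a, A a f) /\
    (forall a (u : nat -> V -> R), (forall n, A a (u n)) ->
        equicontinuous_set S P (range u)).

Definition quasi_DF S P :=
  lcs S P /\ fundamental_bounded_resolution S P /\ class_G S P.

Definition strongly_bounded S P (H : set (V -> R)) :=
  forall B, bounded S P B -> exists M : R, forall f x, H f -> B x -> `|f x| <= M.

Definition DF S P :=
  lcs S P /\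
  (exists Bs : nat -> set V, (forall n, bounded S P (Bs n)) /\
     forall B, bounded S P B -> exists n, B `<=` Bs n) /\
  (forall (H : set (V -> R)) (Hs : nat -> set (V -> R)),
     H `<=` dual S P -> strongly_bounded S P H ->
     H = \bigcup_n Hs n -> (forall n, equicontinuous_set S P (Hs n)) ->
     equicontinuous_set S P H).

Definition metrizable_subset P B :=
  exists d : V -> V -> R,
    (forall x y, B x -> B y -> 0 <= d x y) /\
    (forall x y, B x -> B y -> (d x y = 0 <-> x = y)) /\
    (forall x y, B x -> B y -> d x y = d y x) /\
    (forall x y z, B x -> B y -> B z -> d x z <= d x y + d y z) /\
    (forall x, B x ->
      (forall e : R, 0 < e -> exists (F : seq (V -> R)) (r : R),
          (forall p, p \in F -> P p) /\ 0 < r /\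
          forall y, B y -> \sum_(p <- F) p (y - x) < r -> d x y < e) /\
      (forall (F : seq (V -> R)) (e : R), (forall p, p \in F -> P p) -> 0 < e ->
          exists2 r : R, 0 < r &
          forall y, B y -> d x y < r -> \sum_(p <- F) p (y - x) < e)).

Definition precompact S P B :=
  B `<=` S /\
  forall (F : seq (V -> R)) (e : R), (forall p, p \in F -> P p) -> 0 < e ->
    exists t : seq V, (forall z, z \in t -> S z) /\
      forall x, B x -> exists2 z, z \in t & \sum_(p <- F) p (x - z) < e.

Definition infinite_dimensional S :=
  ~ exists s : seq V, (forall z, z \in s -> S z) /\
      forall x, S x -> exists c : nat -> R,
        x = \sum_(i < size s) c i *: nth 0 s i.

Definition normable S P :=
  exists nrm : V -> R, seminorm_on S nrm /\
    (forall x, S x -> nrm x = 0 -> x = 0) /\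
    cont_sn S P nrm /\
    (forall p, P p -> cont_sn S [set nrm] p).

Definition regular_LM S P :=
  exists (Sn : nat -> set V) (Pn : nat -> set (V -> R)),
    (forall n, lcs (Sn n) (Pn n)) /\
    (forall n, metrizable_subset (Pn n) (Sn n)) /\
    (forall n, Sn n `<=` Sn n.+1) /\
    S = \bigcup_n Sn n /\
    (forall n p, Pn n.+1 p -> cont_sn (Sn n) (Pn n) p) /\
    (* the topology of E is the inductive limit topology *)
    (forall p, P p -> forall n, cont_sn (Sn n) (Pn n) p) /\
    (forall q, seminorm_on S q -> (forall n, cont_sn (Sn n) (Pn n) q) ->
        cont_sn S P q) /\
    (forall B, bounded S P B -> exists n, B `<=` Sn n /\ bounded (Sn n) (Pn n) B).

End LCS.

Definition strong_dual_sn (R : realType) (V : lmodType R) (S : set V)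
    (P : set (V -> R)) : set ((V -> R) -> R) :=
  [set q | exists2 B, bounded S P B & q = fun f => sup [set `|f x| | x in B]].

Section Prod.
Variables (R : realType) (I : countType) (V : I -> lmodType R).
Variables (S : forall i, set (V i)) (P : forall i, set (V i -> R)).

Definition prod_S : set (dprod V) := [set x : dprod V | forall i : I, @S i (x i)].
Definition prod_P : set (dprod V -> R) :=
  [set q | exists i, exists2 p, @P i p & q = fun x => p (x i)].

Definition dsum_S : set (dprod V) :=
  [set x : dprod V | (forall i : I, @S i (x i)) /\ finite_set [set i | x i <> 0]].
(* all seminorms q on the sum whose restriction to each summand
   (q o iota_i) is continuous *)
Definition dsum_P : set (dprod V -> R) :=
  [set q | seminorm_on dsum_S q /\
     forall i, exists (F : seq (V i -> R)) (C : R),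
       (forall p, p \in F -> @P i p) /\
       forall x : dprod V, dsum_S x -> (forall j, j <> i -> x j = 0) ->
         q x <= C * \sum_(p <- F) p (x i)].
End Prod.

(* Main.v *)
Require Import Defs.
From mathcomp Require Import all_boot all_order all_algebra.
From mathcomp Require Import all_classical all_reals.
From mathcomp Require Import lra ring zify.
Set Implicit Arguments. Unset Strict Implicit. Unset Printing Implicit Defensive.
Import Order.TTheory GRing.Theory Num.Theory.
Local Open Scope ring_scope.
Local Open Scope classical_set_scope.

(* Metrizability of precompact sets: by Arzela-Ascoli each member of a class G
   resolution of E' is totally bounded for the seminorm sup_B, B precompact. For
   every e, each index alpha then has a finite prefix such that the union of all
   members whose index extends it has a finite e-net; as there are countably many
   prefixes, E' is sup_B-separable. A dense sequence defines a metric on B, and it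
   induces the right topology because polars of seminorms are themselves totally
   bounded for sup_B and norm the points of E by Hahn-Banach.

   Regular (LM)-spaces E = U E_n: if (q_{n,k})_k are increasing seminorms defining E_n,
   the sets {f : |f| <= alpha(n) q_{n,alpha(n)} on every E_n} are equicontinuous, and
   every strongly bounded subset of E' lies in one of them; they give class G for E and
   a fundamental bounded resolution for E'_beta, while a fundamental bounded resolution of E gives
   class G for E'_beta. Sums and products are handled by coding countably many indices
   into one, a bounded set of a direct sum having finitely many nonzero coordinates. *)

(** * Seminorms and continuity *)

Lemma le_supr (R : realType) (A : set R) (M x : R) :
  (forall y, A y -> y <= M) -> A x -> x <= sup A.
Proof. by move=> AM Ax; apply: ub_le_sup => //; exists M => y /AM. Qed.

(* The junk value [sup set0 = 0] is why [M] has to be nonnegative. *)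
Lemma sup_ler (R : realType) (A : set R) (M : R) :
  0 <= M -> (forall y, A y -> y <= M) -> sup A <= M.
Proof.
move=> M0 AM; have [->|A0] := eqVneq A set0; first by rewrite sup0.
by apply: ge_sup; [exact/set0P | move=> y /AM].
Qed.

Lemma sup_ger0 (R : realType) (A : set R) : (forall y, A y -> 0 <= y) -> 0 <= sup A.
Proof.
move=> A0; have [[[y Ay] [M AM]]|/sup_out->//] := pselect (has_sup A).
by apply: le_trans (A0 _ Ay) _; apply: ub_le_sup => //; exists M.
Qed.

Section Seminorms.
Context {R : realType} {V : lmodType R}.
Implicit Types (S B : set V) (P : set (V -> R)) (p q : V -> R) (f : V -> R).

Definition linear_on S f :=
  forall (a : R) x y, S x -> S y -> f (a *: x + y) = a * f x + f y.

Lemma subspace0 S : linear_subspace S -> S 0. Proof. by case. Qed.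

Lemma subspaceD S x y : linear_subspace S -> S x -> S y -> S (x + y).
Proof. by case=> _ [+ _]; exact. Qed.

Lemma subspaceZ S a x : linear_subspace S -> S x -> S (a *: x).
Proof. by case=> _ [_ +]; exact. Qed.

Lemma subspaceB S x y : linear_subspace S -> S x -> S y -> S (x - y).
Proof.
by move=> hS Sx Sy; rewrite -scaleN1r; apply: subspaceD => //; exact: subspaceZ.
Qed.

Lemma linear_on0 S f : linear_subspace S -> linear_on S f -> f 0 = 0.
Proof.
move=> hS lf; have := lf 1 0 0 (subspace0 hS) (subspace0 hS).
by rewrite scaler0 addr0 mul1r; lra.
Qed.

Lemma linear_onZ S f a x :
  linear_subspace S -> linear_on S f -> S x -> f (a *: x) = a * f x.
Proof.
move=> hS lf Sx; have := lf a x 0 Sx (subspace0 hS).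
by rewrite addr0 (linear_on0 hS lf) addr0.
Qed.

Lemma linear_onD S f x y : linear_on S f -> S x -> S y -> f (x + y) = f x + f y.
Proof. by move=> lf Sx Sy; have := lf 1 _ _ Sx Sy; rewrite scale1r mul1r. Qed.

Lemma linear_onB S f x y : linear_on S f -> S x -> S y -> f (x - y) = f x - f y.
Proof.
by move=> lf Sx Sy; rewrite addrC -scaleN1r lf // mulN1r addrC.
Qed.

Lemma seminorm_on0 S q : linear_subspace S -> seminorm_on S q -> q 0 = 0.
Proof.
case=> S0 _ [_ [_ /(_ 0 0 S0)]]; by rewrite scale0r normr0 mul0r.
Qed.

(** The inequality for [a^-1] at [a *: x] is the reverse of the one for [a]. For suprema only one
    direction of homogeneity is immediate. *)
Lemma seminorm_onP S q : linear_subspace S ->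
  (forall x, S x -> 0 <= q x) ->
  (forall x y, S x -> S y -> q (x + y) <= q x + q y) ->
  (forall (a : R) x, S x -> q (a *: x) <= `|a| * q x) -> seminorm_on S q.
Proof.
move=> hS q0 qD qZ; split=> //; split=> // a x Sx.
apply/eqP; rewrite eq_le qZ //=.
have [->|a0] := eqVneq a 0.
  by rewrite scale0r normr0 mul0r q0 //; exact: subspace0.
have := qZ a^-1 (a *: x) (subspaceZ a hS Sx).
rewrite scalerA mulVf // scale1r normfV => h.
by rewrite -ler_pdivlMl ?normr_gt0.
Qed.

Lemma seminorm_abs S f : linear_subspace S -> linear_on S f ->
  seminorm_on S (fun x => `|f x|).
Proof.
move=> hS lf; split=> //; split=> [x y Sx Sy|a x Sx].
  by rewrite (linear_onD lf) // ler_normD.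
by rewrite (linear_onZ _ hS lf) // normrM.
Qed.

Lemma seminorm_sum S (F : seq (V -> R)) :
  (forall p, p \in F -> seminorm_on S p) ->
  seminorm_on S (fun x => \sum_(p <- F) p x).
Proof.
move=> hF; split=> [x Sx|]; first by rewrite big_seq; apply: sumr_ge0 => p /hF[+ _]; exact.
split=> [x y Sx Sy|a x Sx].
  rewrite -big_split /= big_seq [leRHS]big_seq.
  by apply: ler_sum => p /hF[_ [+ _]]; exact.
rewrite mulr_sumr big_seq [RHS]big_seq.
by apply: eq_bigr => p /hF[_ [_ +]]; exact.
Qed.

Lemma subspace_sum S (I : Type) (s : seq I) (y : I -> V) :
  linear_subspace S -> (forall i, S (y i)) -> S (\sum_(i <- s) y i).
Proof.
move=> hS Sy; elim: s => [|i s IH]; first by rewrite big_nil; exact: subspace0.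
by rewrite big_cons; exact: subspaceD.
Qed.

Lemma seminorm_le_sum S q (I : Type) (s : seq I) (y : I -> V) :
  linear_subspace S -> seminorm_on S q -> (forall i, S (y i)) ->
  q (\sum_(i <- s) y i) <= \sum_(i <- s) q (y i).
Proof.
move=> hS hq Sy; elim: s => [|i s IH]; first by rewrite !big_nil (seminorm_on0 hS hq).
rewrite !big_cons; apply: le_trans (hq.2.1 _ _ (Sy i) _) _; last by rewrite lerD2l.
exact: subspace_sum.
Qed.

(** Pointwise boundedness keeps [sup] off its default value 0; for empty [D] that default gives the
    zero seminorm. *)
Lemma seminorm_sup (T : Type) (D : set T) (q : T -> V -> R) S :
  linear_subspace S -> (forall t, D t -> seminorm_on S (q t)) ->
  (forall x, S x -> exists M, forall t, D t -> q t x <= M) ->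
  seminorm_on S (fun x => sup [set q t x | t in D]).
Proof.
move=> hS hq hb.
have q0 x : S x -> 0 <= sup [set q t x | t in D].
  by move=> Sx; apply: sup_ger0 => _ [t Dt <-]; apply: (hq _ Dt).1.
have qle x t : S x -> D t -> q t x <= sup [set q t x | t in D].
  move=> Sx Dt; have [M hM] := hb _ Sx.
  by apply: (@le_supr _ _ M); [move=> _ [u /hM + <-] | exists t].
apply: seminorm_onP => //.
- move=> x y Sx Sy; apply: sup_ler; first by rewrite addr_ge0 ?q0.
  move=> _ [t Dt <-]; apply: le_trans ((hq _ Dt).2.1 _ _ Sx Sy) _.
  by rewrite lerD ?qle.
- move=> a x Sx; apply: sup_ler; first by rewrite mulr_ge0 ?q0.
  move=> _ [t Dt <-]; rewrite (hq _ Dt).2.2 //.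
  by rewrite ler_wpM2l ?qle.
Qed.

Lemma le_seminorm_sup (T : Type) (D : set T) (q : T -> V -> R) M x t :
  (forall u, D u -> q u x <= M) -> D t -> q t x <= sup [set q u x | u in D].
Proof. by move=> hM Dt; apply: (@le_supr _ _ M); [move=> _ [u /hM + <-]|exists t]. Qed.

Lemma cont_sn_le S P q q' :
  (forall x, S x -> q x <= q' x) -> cont_sn S P q' -> cont_sn S P q.
Proof.
move=> qq' [F [C [hF h]]]; exists F, C; split=> // x Sx.
by apply: le_trans (qq' _ Sx) (h _ Sx).
Qed.

Lemma cont_sn_mem S P p : P p -> cont_sn S P p.
Proof.
move=> Pp; exists [:: p], 1; split; first by move=> q; rewrite inE => /eqP ->.
by move=> x _; rewrite big_seq1 mul1r.
Qed.

Lemma cont_sn0 S P : cont_sn S P (fun=> 0).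
Proof. by exists [::], 0; split=> // x _; rewrite mul0r. Qed.

(** * Continuity with respect to a family of seminorms *)

Section Continuity.
Variables (S : set V) (P : set (V -> R)).
Hypothesis hP : forall p, P p -> seminorm_on S p.

Lemma sum_seminorm_ge0 (F : seq (V -> R)) x :
  (forall p, p \in F -> P p) -> S x -> 0 <= \sum_(p <- F) p x.
Proof. by move=> hF Sx; rewrite big_seq; apply: sumr_ge0 => p /hF/hP[+ _]; exact. Qed.

(** [cont_sn] admits a negative constant; since sums of seminorms are nonnegative, |C| serves as
    well. *)
Lemma cont_sn_ge0 q : cont_sn S P q -> exists F (C : R), 0 <= C /\
  (forall p, p \in F -> P p) /\ forall x, S x -> q x <= C * \sum_(p <- F) p x.
Proof.
move=> [F [C [hF h]]]; exists F, `|C|; do 2!split=> //; move=> x Sx.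
apply: le_trans (h _ Sx) _; apply: ler_wpM2r; last exact: ler_norm.
exact: sum_seminorm_ge0.
Qed.

Lemma cont_snD q q' : cont_sn S P q -> cont_sn S P q' ->
  cont_sn S P (fun x => q x + q' x).
Proof.
move=> /cont_sn_ge0[F [C [C0 [hF h]]]] /cont_sn_ge0[F' [C' [C0' [hF' h']]]].
exists (F ++ F'), (C + C'); split.
  by move=> p; rewrite mem_cat => /orP[/hF|/hF'].
move=> x Sx; rewrite big_cat /=.
have := h _ Sx; have := h' _ Sx.
have := sum_seminorm_ge0 hF Sx; have := sum_seminorm_ge0 hF' Sx.
set a := \sum_(p <- F) _; set b := \sum_(p <- F') _ => b0 a0 ? ?.
have : 0 <= C * b by rewrite mulr_ge0.
have : 0 <= C' * a by rewrite mulr_ge0.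
by lra.
Qed.

Lemma cont_snZ q c : 0 <= c -> cont_sn S P q -> cont_sn S P (fun x => c * q x).
Proof.
move=> c0 [F [C [hF h]]]; exists F, (c * C); split=> // x Sx.
by rewrite -mulrA ler_wpM2l ?h.
Qed.

Lemma cont_sn_sum (I : eqType) (s : seq I) (q : I -> V -> R) :
  (forall i, i \in s -> cont_sn S P (q i)) ->
  cont_sn S P (fun x => \sum_(i <- s) q i x).
Proof.
elim: s => [|i s IH] h.
  by apply: cont_sn_le (cont_sn0 _ _) => x _; rewrite big_nil.
apply: (@cont_sn_le _ _ _ (fun x => q i x + \sum_(j <- s) q j x)).
  by move=> x _; rewrite big_cons.
apply: cont_snD; first by apply: h; rewrite mem_head.
by apply: IH => j js; apply: h; rewrite inE js orbT.
Qed.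

Lemma bounded_cont_sn B q : bounded S P B -> cont_sn S P q ->
  exists2 M : R, 0 <= M & forall x, B x -> q x <= M.
Proof.
move=> [BS hB] /cont_sn_ge0[F [C [C0 [hF h]]]].
have [M M0 hM] : exists2 M : R, 0 <= M & forall x, B x -> \sum_(p <- F) p x <= M.
  elim: F hF {h} => [|p F IH] hF.
    by exists 0 => // x _; rewrite big_nil.
  have [|M M0 hM] := IH; first by move=> r rF; apply: hF; rewrite inE rF orbT.
  have [|N hN] := hB p; first by apply: hF; rewrite mem_head.
  exists (`|N| + M); first by rewrite addr_ge0.
  move=> x Bx; rewrite big_cons lerD ?hM //.
  exact: le_trans (hN _ Bx) (ler_norm _).
exists (C * M); first by rewrite mulr_ge0.
by move=> x Bx; apply: le_trans (h _ (BS _ Bx)) _; rewrite ler_wpM2l ?hM.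
Qed.

Lemma bounded_sup_ge B q : bounded S P B -> cont_sn S P q ->
  forall x, B x -> q x <= sup [set q x | x in B].
Proof.
move=> bB cq x Bx; have [M M0 hM] := bounded_cont_sn bB cq.
by apply: (@le_supr _ _ M); [move=> _ [y /hM + <-] | exists x].
Qed.

End Continuity.

Lemma boundedU S P B B' : bounded S P B -> bounded S P B' -> bounded S P (B `|` B').
Proof.
move=> [BS hB] [BS' hB']; split; first by move=> x [/BS|/BS'].
move=> p Pp; have [M hM] := hB _ Pp; have [N hN] := hB' _ Pp.
exists (Num.max M N) => x [/hM|/hN] h; rewrite le_max h ?orbT //.
Qed.

Lemma bounded0 S P : bounded S P set0.
Proof. by split=> // p _; exists 0. Qed.

Lemma bounded1 S P x : S x -> bounded S P [set x].
Proof. by move=> Sx; split=> [_ ->//|p _]; exists (p x) => _ ->. Qed.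

(** Packs the finite family and the constant into one dominating function, so that equicontinuity
    can be proved by exhibiting an upper envelope. *)
Lemma equicontinuousP S P H : equicontinuous_set S P H <->
  exists2 q, cont_sn S P q & forall f x, H f -> S x -> `|f x| <= q x.
Proof.
split=> [[F [C [hF h]]]|[q [F [C [hF h]]] hq]].
  by exists (fun x => C * \sum_(p <- F) p x) => //; exists F, C.
exists F, C; split=> // f x Hf Sx; exact: le_trans (hq _ _ Hf Sx) (h _ Sx).
Qed.

Lemma dual_linear S P f : dual S P f -> linear_on S f.
Proof. by case=> _ []. Qed.

Lemma dual_cont S P f : dual S P f -> cont_sn S P (fun x => `|f x|).
Proof. by case=> _ []. Qed.

Lemma dual0 S P : dual S P (fun=> 0).
Proof.
split=> //; split=> [a x y _ _|]; first by rewrite mulr0 addr0.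
by apply: cont_sn_le (cont_sn0 _ _) => x _; rewrite normr0.
Qed.

End Seminorms.

(** Continuity of [T] is tested on generators only. It is applied to inclusions of steps, embeddings
    of summands and coordinate projections. *)
Lemma cont_sn_comp (R : realType) (V W : lmodType R) (S : set V)
    (P : set (V -> R)) (S' : set W) (P' : set (W -> R)) (T : V -> W) q :
  (forall p, P p -> seminorm_on S p) -> (forall p, P' p -> seminorm_on S' p) ->
  (forall x, S x -> S' (T x)) ->
  (forall p, P' p -> cont_sn S P (fun x => p (T x))) ->
  cont_sn S' P' q -> cont_sn S P (fun x => q (T x)).
Proof.
move=> hP hP' hT hc /(cont_sn_ge0 hP')[F [C [C0 [hF h]]]].
apply: (@cont_sn_le _ _ _ _ _ (fun x => C * \sum_(p <- F) p (T x))).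
  by move=> x Sx; exact/h/hT.
by apply: cont_snZ => //; apply: cont_sn_sum => // p /hF; exact: hc.
Qed.

(** * Hahn-Banach *)

Section HahnBanach.
Context {R : realType} {V : lmodType R}.
Implicit Types (S T : set V) (P : set (V -> R)) (p : V -> R) (G : set (V * R)).

(* The bound by [p] makes [G] single-valued, since [(0, r) \in G] forces [r = 0]. *)
Definition dominated_graph S p G :=
  G (0, 0) /\
  (forall (a : R) x y r s, G (x, r) -> G (y, s) -> G (a *: x + y, a * r + s)) /\
  (forall x r, G (x, r) -> S x /\ r <= p x).

Section Extension.
Variables (S : set V) (p : V -> R).
Hypotheses (hS : linear_subspace S) (hp : seminorm_on S p).

Lemma dominated_graphZ G (a : R) x r :
  dominated_graph S p G -> G (x, r) -> G (a *: x, a * r).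
Proof. by case=> G0 [GD _] Gx; have := GD a _ _ _ _ Gx G0; rewrite !addr0. Qed.

Lemma dominated_graph_abs G x r : dominated_graph S p G -> G (x, r) -> `|r| <= p x.
Proof.
move=> hG Gx; have [Sx rp] := hG.2.2 _ _ Gx.
have [_] := hG.2.2 _ _ (dominated_graphZ (-1) hG Gx).
rewrite (hp.2.2) // normrN1 mul1r mulN1r => rp'.
by rewrite ler_norml; apply/andP; split; lra.
Qed.

Lemma dominated_graph_inj G x r s :
  dominated_graph S p G -> G (x, r) -> G (x, s) -> r = s.
Proof.
move=> hG Gr Gs; have := hG.2.1 (-1) _ _ _ _ Gr Gs.
rewrite scaleN1r addNr => /(dominated_graph_abs hG).
by rewrite (seminorm_on0 hS hp) normr_le0 => /eqP; lra.
Qed.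

(** The value [c] at [x0] has to lie above every [r - p (x - x0)] and below every [p (y + x0) - s].
    Subadditivity at [x - x0] and [y + x0] shows that this gap is not empty, and [c] is its left
    end. *)
Lemma dominated_graph_extend G x0 : dominated_graph S p G -> S x0 ->
  exists c : R, dominated_graph S p
    [set z | exists t x r, G (x, r) /\ z = (x + t *: x0, r + t * c)].
Proof.
move=> hG Sx0; have [G0 [GD GS]] := hG.
have key x r y s : G (x, r) -> G (y, s) -> r - p (x - x0) <= p (y + x0) - s.
  move=> Gx Gy; have := GD 1 _ _ _ _ Gx Gy; rewrite scale1r mul1r => /GS[_ rs].
  have [Sx _] := GS _ _ Gx; have [Sy _] := GS _ _ Gy.
  have := hp.2.1 (x - x0) (y + x0) (subspaceB hS Sx Sx0) (subspaceD hS Sy Sx0).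
  by rewrite addrACA addNr addr0; lra.
pose A : set R := [set z | exists x r, G (x, r) /\ z = r - p (x - x0)].
exists (sup A); set c := sup A.
have lec x r : G (x, r) -> r - p (x - x0) <= c.
  move=> Gx; apply: (@le_supr _ _ (p (0 + x0) - 0)); last by exists x, r.
  by move=> _ [y [s [Gy ->]]]; exact: key.
have gec y s : G (y, s) -> c <= p (y + x0) - s.
  move=> Gy; apply: ge_sup; first by exists (0 - p (0 - x0)); exists 0, 0.
  by move=> _ [x [r [Gx ->]]]; exact: key.
split; [|split].
- by exists 0, 0, 0; split=> //; rewrite scale0r addr0 mul0r addr0.
- move=> a _ _ _ _ [t [x [r [Gx [-> ->]]]]] [u [y [s [Gy [-> ->]]]]].
  exists (a * t + u), (a *: x + y), (a * r + s); split; first exact: GD.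
  congr pair; last by ring.
  by rewrite scalerDr scalerA addrACA -scalerDl.
move=> _ _ [t [x [r [Gx [-> ->]]]]]; have [Sx rp] := GS _ _ Gx.
split; first by apply: subspaceD => //; exact: subspaceZ.
(* Division by |t| reduces the bound to [gec] for positive [t] and to [lec] for negative [t]. *)
have [t0|t0|<-] := ltgtP 0 t.
- have := gec _ _ (dominated_graphZ t^-1 hG Gx).
  have -> : x + t *: x0 = t *: (t^-1 *: x + x0).
    by rewrite scalerDr scalerA divff ?scale1r ?gt_eqF.
  rewrite hp.2.2; last by apply: subspaceD => //; exact: subspaceZ.
  rewrite gtr0_norm // => h.
  have : c + t^-1 * r <= p (t^-1 *: x + x0) by lra.
  rewrite -(ler_pM2l t0) mulrDr mulrA divff ?gt_eqF //; lra.
- have u0 : 0 < - t by lra.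
  have := lec _ _ (dominated_graphZ (- t)^-1 hG Gx).
  have -> : x + t *: x0 = (- t) *: ((- t)^-1 *: x - x0).
    by rewrite scalerBr scalerA divff ?gt_eqF // scale1r scaleNr opprK.
  rewrite hp.2.2; last by apply: subspaceB => //; exact: subspaceZ.
  rewrite (gtr0_norm u0) => h.
  have : (- t)^-1 * r - c <= p ((- t)^-1 *: x - x0) by lra.
  rewrite -(ler_pM2l u0) mulrBr mulrA divff ?gt_eqF //; lra.
- by rewrite scale0r mul0r !addr0.
Qed.

Lemma hahn_banach_graph G0 : dominated_graph S p G0 ->
  exists f : V -> R, [/\ linear_on S f, (forall x, ~ S x -> f x = 0),
    (forall x, S x -> `|f x| <= p x) & (forall x r, G0 (x, r) -> f x = r)].
Proof.
move=> hG0.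
(* Adjoining [G0] to each candidate lets the union of the empty chain qualify as well. *)
have [|A [hA maxA]] := @Zorn_bigcup _ [set A | dominated_graph S p (A `|` G0)].
  move=> F FP totF; split; [|split].
  - by right; exact: hG0.1.
  - move=> a x y r s [[X FX Xx]|Gx] [[Y FY Yy]|Gy].
    + have [XY|YX] := totF _ _ FX FY.
      * have [] := (FP _ FY).2.1 a x y r s; [by left; exact: XY|by left| |].
          by move=> h; left; exists Y.
        by right.
      * have [] := (FP _ FX).2.1 a x y r s; [by left|by left; exact: YX| |].
          by move=> h; left; exists X.
        by right.
    + have [] := (FP _ FX).2.1 a x y r s; [by left|by right| |by right].
      by move=> h; left; exists X.
    + have [] := (FP _ FY).2.1 a x y r s; [by right|by left| |by right].
      by move=> h; left; exists Y.
    + by right; exact: hG0.2.1.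
  - move=> x r [[X FX Xx]|Gx]; last exact: hG0.2.2.
    by apply: (FP _ FX).2.2; left.
set M := A `|` G0 in hA *.
have dom x0 : S x0 -> exists r, M (x0, r).
  move=> Sx0; apply: contrapT => /forallNP nM.
  have [c hc] := dominated_graph_extend hA Sx0.
  set M' := [set z | _] in hc.
  have MM' : M `<=` M'.
    move=> [x r] Mx; exists 0, x, r; split=> //.
    by rewrite scale0r mul0r !addr0.
  have M'E : M' `|` G0 = M'.
    by apply/seteqP; split=> [z [//|Gz]|z Mz]; [apply: MM'; right|left].
  (* [M'] contains [(x0, c)]; were it contained in [A], then [x0] would already have a value. *)
  apply: (maxA M'); last by rewrite /= M'E.
  split; first by move=> z Az; apply: MM'; left.
  move=> h; apply: (nM c); left; apply: h; exists 1, 0, 0.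
  by split; [exact: hA.1|rewrite scale1r mul1r !add0r].
have /choice[f hf] x : exists r, (S x -> M (x, r)) /\ (~ S x -> r = 0).
  have [Sx|nSx] := pselect (S x); last by exists 0.
  by have [r Mr] := dom _ Sx; exists r.
exists f; split.
- move=> a x y Sx Sy; apply: (dominated_graph_inj hA).
    apply: (hf _).1; apply: subspaceD => //; exact: subspaceZ.
  by apply: hA.2.1; exact: (hf _).1.
- by move=> x /(hf _).2.
- by move=> x Sx; apply: (dominated_graph_abs hA); exact: (hf _).1.
- move=> x r Gx; have [Sx _] := hG0.2.2 _ _ Gx.
  by apply: (dominated_graph_inj hA) ((hf _).1 Sx) _; right.
Qed.

Lemma hahn_banach T f : linear_subspace T -> T `<=` S -> linear_on T f ->
  (forall x, T x -> `|f x| <= p x) ->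
  exists g : V -> R, [/\ linear_on S g, (forall x, ~ S x -> g x = 0),
    (forall x, S x -> `|g x| <= p x) & (forall x, T x -> g x = f x)].
Proof.
move=> hT TS lf fp.
have [|g [? ? ? gf]] := @hahn_banach_graph [set z | T z.1 /\ f z.1 = z.2].
  split; [|split].
  - by split; [exact: subspace0|exact: linear_on0 lf].
  - move=> a x y r s [/= Tx <-] [/= Ty <-]; split=> /=; last exact: lf.
    by apply: subspaceD => //; exact: subspaceZ.
  - move=> x r [/= Tx <-]; split; first exact: TS.
    exact: le_trans (ler_norm _) (fp _ Tx).
by exists g; split=> // x Tx; exact: gf.
Qed.

(** The functional norming [z], extended from the line through [z]. Describing the start as a graph
    avoids treating [z = 0] apart. *)
Lemma hahn_banach_point z : S z ->
  exists f : V -> R, [/\ linear_on S f, (forall x, ~ S x -> f x = 0),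
    (forall x, S x -> `|f x| <= p x) & f z = p z].
Proof.
move=> Sz.
have [|g [? ? ? gf]] := @hahn_banach_graph [set w | exists t : R, w = (t *: z, t * p z)].
  split; [|split].
  - by exists 0; rewrite scale0r mul0r.
  - move=> a _ _ _ _ [t [-> ->]] [u [-> ->]]; exists (a * t + u).
    by rewrite scalerDl scalerA mulrDl mulrA.
  - move=> _ _ [t [-> ->]]; split; first exact: subspaceZ.
    by rewrite hp.2.2 // ler_wpM2r ?ler_norm ?hp.1.
exists g; split=> //; apply: gf; exists 1; by rewrite scale1r mul1r.
Qed.

End Extension.
End HahnBanach.

(** * Precompact sets in class G *)

Lemma exists_inv_nat_lt (R : realType) (e : R) : 0 < e -> exists n : nat, n.+1%:R^-1 < e.
Proof.
move=> e0; exists (Num.bound e^-1).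
rewrite -[ltRHS]invrK ltf_pV2 ?posrE ?invr_gt0 ?ltr0n //.
have := archi_boundP (ltW (_ : 0 < e^-1)); rewrite invr_gt0 => /(_ e0) h.
by apply: lt_trans h _; rewrite ltr_nat.
Qed.

Section Nets.
Context {R : realType} {V : lmodType R}.
Implicit Types (S B : set V) (P : set (V -> R)) (p q : V -> R) (f g : V -> R).

(** Distances are those of the supremum seminorm on [B], written pointwise so that no supremum has
    to be shown finite. Where the centres lie is left to each use. *)
Definition finite_net (B : set V) (e : R) (H : set (V -> R)) (l : seq (V -> R)) :=
  forall f, H f -> exists2 g, g \in l & forall x, B x -> `|f x - g x| <= e.

(** Total boundedness of a bounded set in finitely many real coordinates. By induction on [t], [H]
    is cut into slices on which the value at [z] varies by less than [e]; the nets of the slices are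
    concatenated, and their centres stay in [H]. *)
Lemma finite_net_on_seq (q : V -> R) (t : seq V) (e : R) (H : set (V -> R)) :
  0 < e -> (forall f z, H f -> z \in t -> `|f z| <= q z) ->
  exists2 l : seq (V -> R), (forall g, g \in l -> H g)
    & finite_net [set` t] e H l.
Proof.
move=> e0; elim: t H => [|z t IH] H hH.
  have [[f Hf]|/forallNP nH] := pselect (exists f, H f).
    exists [:: f]; first by move=> g; rewrite inE => /eqP ->.
    by move=> g _; exists f; rewrite ?mem_head.
  by exists [::] => // f /nH.
pose Hn (n : nat) : set (V -> R) :=
  [set f | H f /\ n%:R * e <= f z + q z < n.+1%:R * e].
have /choice[l hl] n : exists l : seq (V -> R),
    (forall g, g \in l -> Hn n g) /\ finite_net [set` t] e (Hn n) l.
  have [|l l1 l2] := IH (Hn n); last by exists l.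
  by move=> f x [Hf _] xt; apply: hH => //; rewrite inE xt orbT.
have [q0|q0] := leP 0 (q z); last first.
  exists [::] => // f Hf.
  have := hH f z Hf (mem_head _ _).
  by move=> /(le_trans (normr_ge0 _)); rewrite leNgt q0.
(* Since |f z| <= q z, the number [f z + q z] lies between 0 and [q z + q z], so no slice beyond [N]
   is inhabited. *)
pose N := Num.bound ((q z + q z) / e).
exists (flatten [seq l n | n <- iota 0 N.+1]).
  by move=> g /flatten_mapP[n _ /(hl n).1[]].
move=> f Hf; have := hH f z Hf (mem_head _ _); rewrite ler_norml => /andP[f1 f2].
have a0 : 0 <= (f z + q z) / e by apply: divr_ge0; [lra|exact: ltW].
have /andP[n1 n2] := Num.Theory.truncn_itv a0.
set n := Num.truncn _ in n1 n2.
have nN : (n < N.+1)%N.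
  rewrite ltnS -(ler_nat R); apply: le_trans n1 _; apply: ltW.
  apply: le_lt_trans (archi_boundP (divr_ge0 (addr_ge0 q0 q0) (ltW e0))).
  by apply: ler_wpM2r; [rewrite invr_ge0 ltW|lra].
have Hnf : Hn n f by split=> //; rewrite -ler_pdivlMr // n1 -ltr_pdivrMr.
have [g gl hg] := (hl n).2 f Hnf; exists g.
  by apply/flatten_mapP; exists n => //; rewrite mem_iota.
move=> x /=; rewrite inE => /orP[/eqP ->|/hg//].
have [_ /andP[g1 g2]] := (hl n).1 _ gl; case: Hnf => _ /andP[f3 f4].
rewrite -natr1 in g2 f4.
by rewrite ler_norml; apply/andP; split; lra.
Qed.

(* Arzela-Ascoli *)
Lemma equicontinuous_finite_net S P B (H : set (V -> R)) (e : R) :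
  lcs S P -> precompact S P B -> (forall f, H f -> linear_on S f) ->
  equicontinuous_set S P H -> 0 < e ->
  exists2 l : seq (V -> R), (forall g, g \in l -> H g) & finite_net B e H l.
Proof.
move=> [hS [hP _]] [BS hB] hl [F [C0 [hF hC0]]] e0.
pose C := `|C0| + 1; have Cgt0 : 0 < C by rewrite ltr_wpDl.
have hC f x : H f -> S x -> `|f x| <= C * \sum_(p <- F) p x.
  move=> Hf Sx; apply: le_trans (hC0 _ _ Hf Sx) _; apply: ler_wpM2r.
    exact: sum_seminorm_ge0 hP _ _ _ _.
  by rewrite /C; apply: le_trans (ler_norm _) _; lra.
(* Three errors of [e / 4] will add up: moving [f] and then [g] from [x] to a nearby [z] in [t], and
   comparing them at [z]. *)
have d0 : 0 < e / 4 / C by rewrite !divr_gt0.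
have [t [tS ht]] := hB F _ hF d0.
have e20 : 0 < e / 4 by rewrite divr_gt0.
have [|l lH net] := @finite_net_on_seq (fun x => C * \sum_(p <- F) p x) t _ H e20.
  by move=> f z Hf /tS; exact: hC.
exists l => // f Hf; have [g gl hg] := net _ Hf; exists g => // x Bx.
have [z zt hz] := ht _ Bx; have Sx := BS _ Bx; have Sz := tS _ zt.
have close h : H h -> `|h x - h z| <= e / 4.
  move=> Hh; rewrite -(linear_onB (hl _ Hh)) //.
  apply: le_trans (hC _ _ Hh (subspaceB hS Sx Sz)) _.
  by rewrite mulrC -ler_pdivlMr // ltW.
have := hg _ zt; have := close _ Hf; have := close _ (lH _ gl).
rewrite !ler_norml => /andP[? ?] /andP[? ?] /andP[? ?].
by apply/andP; split; lra.
Qed.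

(* If no net existed for any of the sets below, one could pick a sequence in some
   member [A gamma], with [gamma] above all the indices used, whose terms
   are pairwise far apart on [B]. *)
Lemma resolution_finite_net S P B (A : (nat -> nat) -> set (V -> R)) (e : R) a :
  lcs S P -> precompact S P B -> (forall a, A a `<=` dual S P) ->
  (forall a b, nn_le a b -> A a `<=` A b) ->
  (forall a (u : nat -> V -> R), (forall n, A a (u n)) ->
        equicontinuous_set S P (range u)) -> 0 < e ->
  exists k (l : seq (V -> R)), (forall g, g \in l -> dual S P g) /\
    finite_net B e
      [set f | exists2 b, A b f & forall i, (i < k)%N -> b i = a i] l.
Proof.
move=> hE hB AS Amono Aeq e0; apply: contrapT => nk.
(* [h] answers a prefix length and a finite list in the dual with a functional far from the whole
   list, whose index agrees with [a] on that prefix. Lists outside the dual get a dummy answer. *)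
have /choice[h hh] (kl : nat * seq (V -> R)) : exists fb : (V -> R) * (nat -> nat),
    (forall g, g \in kl.2 -> dual S P g) ->
    [/\ A fb.2 fb.1, (forall i, (i < kl.1)%N -> fb.2 i = a i)
      & forall g, g \in kl.2 -> exists2 x, B x & e < `|fb.1 x - g x|].
  have [hl|] := pselect (forall g, g \in kl.2 -> dual S P g); last first.
    by move=> nh; exists ((fun=> 0), a) => /nh.
  apply: contrapT => nfb; apply: nk; exists kl.1, kl.2; split=> //.
  move=> f [b Af hb]; apply: contrapT => nf; apply: nfb; exists (f, b) => _.
  split=> // g gl; apply: contrapT => nx; apply: nf; exists g => // x Bx.
  by rewrite leNgt; apply/negP => xe; apply: nx; exists x.
pose L := fix L n := if n is m.+1 then (h (m, L m)).1 :: L m else [::].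
pose u n := (h (n, L n)).1; pose b n := (h (n, L n)).2.
have dL n : forall g, g \in L n -> dual S P g.
  elim: n => [//|n IH] g; rewrite inE => /orP[/eqP ->|/IH//].
  by have [+ _ _] := hh (n, L n) IH; exact: AS.
have Au n : A (b n) (u n) by have [] := hh (n, L n) (dL n).
have ba n i : (i < n)%N -> b n i = a i by have [_ + _] := hh (n, L n) (dL n); exact.
have uL m n : (m < n)%N -> u m \in L n.
  elim: n => [//|n IH]; rewrite ltnS leq_eqVlt => /orP[/eqP ->|/IH h'].
    by rewrite mem_head.
  by rewrite inE h' orbT.
(* By [ba], [b n i] can differ from [a i] only when [n <= i], so a finite maximum bounds the [i]-th
   entries of all the indices. *)
pose c i := (a i + \max_(n < i.+1) b n i)%N.
have bc n : nn_le (b n) c.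
  move=> i; have [ni|ni] := ltnP n i.+1.
    by apply: leq_trans (leq_addl _ _); exact: (leq_bigmax (Ordinal ni)).
  by rewrite ba // leq_addr.
have Acu n : A c (u n) by apply: Amono (bc n) _ (Au n).
have hlin f : range u f -> linear_on S f.
  by move=> [n _ <-]; exact: dual_linear (AS _ _ (Acu n)).
have [l lu net] := equicontinuous_finite_net hE hB hlin (Aeq _ _ Acu) e0.
have [N hN] : exists N, forall g, g \in l -> exists2 n, (n < N)%N & g = u n.
  elim: l lu {net} => [|g l IH] lu; first by exists 0%N.
  have [|N hN] := IH; first by move=> k kl; apply: lu; rewrite inE kl orbT.
  have [n _ <-] := lu g (mem_head _ _); exists (maxn N n.+1) => k.
  rewrite inE => /orP[/eqP ->|/hN[m mN ->]]; [exists n|exists m] => //; lia.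
(* [u N] is within [e] of some earlier [u n], although it was chosen far from every member of
   [L N]. *)
have [g gl hg] := net (u N) (ex_intro2 _ _ N I erefl).
have [n nN gE] := hN _ gl; rewrite {g gl}gE in hg.
have [_ _ /(_ (u n) (uL _ _ nN))[x Bx]] := hh (N, L N) (dL N).
by rewrite ltNge hg.
Qed.

(** Pairs of a finite prefix and a precision are countable. For each pair one finite net is fixed if
    any exists, and [g] enumerates all these nets; [resolution_finite_net] guarantees a net for some
    prefix of the index of any given [f]. *)
Lemma class_G_dense_sequence S P B : lcs S P -> class_G S P -> precompact S P B ->
  exists g : nat -> V -> R, (forall n, dual S P (g n)) /\
    forall f (e : R), dual S P f -> 0 < e ->
      exists n, forall x, B x -> `|f x - g n x| <= e.
Proof.
move=> hE [A [AS [Amono [Acov Aeq]]]] hB.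
pose C (s : seq nat) : set (V -> R) :=
  [set f | exists2 b, A b f & forall i, (i < size s)%N -> b i = nth 0%N s i].
have /choice[N hN] (sm : seq nat * nat) : exists l : seq (V -> R),
    (forall g, g \in l -> dual S P g) /\
    ((exists l' : seq (V -> R), (forall g, g \in l' -> dual S P g) /\
        finite_net B sm.2.+1%:R^-1 (C sm.1) l') ->
      finite_net B sm.2.+1%:R^-1 (C sm.1) l).
  have [[l [l1 l2]]|nl] := pselect (exists l' : seq (V -> R),
    (forall g, g \in l' -> dual S P g) /\
        finite_net B sm.2.+1%:R^-1 (C sm.1) l'); first by exists l.
  by exists [::].
(* Numbers that code nothing, and positions past the end of a net, give the zero functional, which
   lies in the dual. *)
pose g n : V -> R := if @unpickle (seq nat * nat * nat)%type n is Some (sm, j)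
  then nth (fun=> 0) (N sm) j else (fun=> 0).
exists g; split.
  move=> n; rewrite /g; case: unpickle => [[sm j]|]; last exact: dual0.
  have [jN|jN] := ltnP j (size (N sm)).
    by apply: (hN sm).1; exact: mem_nth.
  by rewrite nth_default //; exact: dual0.
move=> f e df e0; have [m me] := exists_inv_nat_lt e0.
have [a Af] := Acov _ df.
have m0 : 0 < m.+1%:R^-1 :> R by rewrite invr_gt0 ltr0n.
have [k [l [l1 l2]]] := resolution_finite_net a hE hB AS Amono Aeq m0.
pose s := mkseq a k.
have net : finite_net B m.+1%:R^-1 (C s) l.
  move=> h [b Ab hb]; apply: l2; exists b => // i ik.
  by have := hb i; rewrite /s size_mkseq nth_mkseq //; exact.
have [|h hl hh] := (hN (s, m)).2 (ex_intro _ l (conj l1 net)) f.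
  by exists a => // i; rewrite size_mkseq => ik; rewrite nth_mkseq.
exists (pickle ((s, m), index h (N (s, m)))) => x Bx.
by rewrite /g pickleK nth_index // (le_trans (hh _ Bx)) ?ltW.
Qed.

(* On a precompact set [p] is, up to [e], the supremum over a finite net of
   its polar. *)
Lemma seminorm_controlled S P B (g : nat -> V -> R) p (e : R) :
  lcs S P -> precompact S P B -> (forall n, dual S P (g n)) ->
  (forall f (e : R), dual S P f -> 0 < e ->
      exists n, forall x, B x -> `|f x - g n x| <= e) ->
  P p -> 0 < e -> exists N (d : R), 0 < d /\ forall x y, B x -> B y ->
    (forall n, (n < N)%N -> `|g n y - g n x| <= d) -> p (y - x) < e.
Proof.
move=> hE hB hg gd Pp e0; have [hS [hP _]] := hE; have [BS _] := hB.
pose H : set (V -> R) := [set f | dual S P f /\ forall x, S x -> `|f x| <= p x].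
have Hlin f : H f -> linear_on S f by move=> [/dual_linear].
have Heq : equicontinuous_set S P H.
  apply/equicontinuousP; exists p; first exact: cont_sn_mem.
  by move=> f x [_]; exact.
(* [f y - f x] is estimated through [h] and [g n]: two errors at [x], two at [y], and the difference
   of [g n] itself, five terms of [e / 8] in all. *)
have d0 : 0 < e / 8 by rewrite divr_gt0.
have [l lH net] := equicontinuous_finite_net hE hB Hlin Heq d0.
have [N hN] : exists N, forall h, h \in l -> exists2 n, (n < N)%N &
    forall x, B x -> `|h x - g n x| <= e / 8.
  elim: l lH {net} => [|h l IH] lH; first by exists 0%N.
  have [|N hN] := IH; first by move=> k kl; apply: lH; rewrite inE kl orbT.
  have [n hn] := gd h _ (lH h (mem_head _ _)).1 d0; exists (maxn N n.+1) => k.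
  rewrite inE => /orP[/eqP ->|/hN[m mN ?]]; [exists n|exists m] => //; lia.
exists N, (e / 8); split=> // x y Bx By hxy.
have Syx : S (y - x) by apply: subspaceB => //; exact: BS.
(* A member of the polar of [p] that attains [p (y - x)]. *)
have [f [lf f0 fp fz]] := hahn_banach_point hS (hP _ Pp) Syx.
have Hf : H f.
  do 2!split=> //; split=> //.
  by apply: cont_sn_le (cont_sn_mem _ Pp) => z; exact: fp.
have [h hl hfh] := net _ Hf; have [n nN hgn] := hN _ hl.
rewrite -fz (linear_onB lf); [|exact: BS|exact: BS].
have := hxy _ nN; have := hgn _ Bx; have := hgn _ By.
have := hfh _ Bx; have := hfh _ By.
rewrite !ler_norml => /andP[? ?] /andP[? ?] /andP[? ?] /andP[? ?] /andP[? ?].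
lra.
Qed.

Lemma sum_seminorm_controlled (B : set V) (g : nat -> V -> R) (F : seq (V -> R)) :
  (forall p (e : R), p \in F -> 0 < e -> exists N (d : R), 0 < d /\
    forall x y, B x -> B y ->
    (forall n, (n < N)%N -> `|g n y - g n x| <= d) -> p (y - x) < e) ->
  forall e : R, 0 < e -> exists N (d : R), 0 < d /\ forall x y, B x -> B y ->
    (forall n, (n < N)%N -> `|g n y - g n x| <= d) -> \sum_(p <- F) p (y - x) < e.
Proof.
elim: F => [|p F IH] hF e e0.
  by exists 0%N, 1; split=> // x y _ _ _; rewrite big_nil.
have e20 : 0 < e / 2 by rewrite divr_gt0.
have [N [d [d0 hN]]] := hF p _ (mem_head _ _) e20.
have [|N' [d' [d'0 hN']]] := IH _ _ e20.
  by move=> q e' qF; apply: hF; rewrite inE qF orbT.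
exists (maxn N N'), (Num.min d d'); split; first by rewrite lt_min d0 d'0.
move=> x y Bx By hxy; rewrite big_cons [e]splitr ltrD //.
  by apply: hN => // n nN; apply: le_trans (hxy _ _) _; [lia|rewrite ge_min lexx].
by apply: hN' => // n nN; apply: le_trans (hxy _ _) _; [lia|rewrite ge_min lexx orbT].
Qed.

Lemma class_G_precompact_metrizable S P B :
  lcs S P -> class_G S P -> precompact S P B -> metrizable_subset P B.
Proof.
move=> hE hG hB; have [g [hg gd]] := class_G_dense_sequence hE hG hB.
have [hS [hP sep]] := hE; have [BS _] := hB.
have ctrl F e : (forall p, p \in F -> P p) -> 0 < e ->
    exists N (d : R), 0 < d /\ forall x y, B x -> B y ->
    (forall n, (n < N)%N -> `|g n y - g n x| <= d) -> \sum_(p <- F) p (y - x) < e.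
  move=> hF; apply: sum_seminorm_controlled => p {}e /hF Pp.
  exact: seminorm_controlled hE hB hg gd Pp.
(* The cap [1 / (n + 1)] keeps the supremum finite and makes the terms with [n >= N] at most
   [1 / (N + 1)], so that small distances are decided by finitely many functionals. *)
pose m n x y : R := Num.min `|g n x - g n y| n.+1%:R^-1.
pose d x y : R := sup [set m n x y | n in [set: nat]].
have m1 n x y : m n x y <= 1.
  by rewrite ge_min invf_le1 ?ltr0n // ler1n orbT.
have m0 n x y : 0 <= m n x y by rewrite le_min normr_ge0 invr_ge0 ler0n.
have le_d n x y : m n x y <= d x y.
  by apply: (@le_supr _ _ 1); [move=> _ [k _ <-] | exists n].
have d_le (M : R) x y : 0 <= M -> (forall n, m n x y <= M) -> d x y <= M.
  by move=> M0 hM; apply: sup_ler => // _ [n _ <-].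
have d0 x y : 0 <= d x y by apply: le_trans (m0 0%N x y) (le_d _ _ _).
(* Below [1 / (N + 1)] the caps with [n < N] are not attained, so [d] bounds the first [N]
   differences themselves. *)
have small N (r : R) : 0 < r -> exists2 s : R, 0 < s & forall x y, d x y < s ->
    forall n, (n < N)%N -> `|g n y - g n x| <= r.
  move=> r0; exists (Num.min r N.+1%:R^-1); first by rewrite lt_min r0 invr_gt0 ltr0n.
  move=> x y; rewrite lt_min => /andP[dr dN] n nN.
  have := le_lt_trans (le_d n x y) dr; rewrite gt_min => /orP[h|h].
    by rewrite distrC ltW.
  have := le_lt_trans (le_d n x y) dN; rewrite gt_min => /orP[h'|].
    suff : N.+1%:R^-1 <= r by move=> ?; rewrite distrC; apply: ltW; apply: lt_le_trans h' _.
    apply: ltW; apply: le_lt_trans h.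
    by rewrite lef_pV2 ?posrE ?ltr0n // ler_nat; lia.
  by rewrite ltf_pV2 ?posrE ?ltr0n // ltr_nat; lia.
exists d; split; [|split; [|split; [|split]]].
- by [].
- move=> x y Bx By; split=> [dxy|->]; last first.
    apply/eqP; rewrite eq_le d0 andbT; apply: d_le => // n.
    by rewrite /m subrr normr0 ge_min lexx.
  apply: contrapT => xy; have [||p Pp /eqP pn] := sep (y - x).
  - by apply: subspaceB => //; exact: BS.
  - by move=> /eqP; rewrite subr_eq0 => /eqP yx; apply: xy.
  have Syx : S (y - x) by apply: subspaceB => //; exact: BS.
  have p0 : 0 < p (y - x) by rewrite lt_neqAle eq_sym pn (hP _ Pp).1.
  (* At precision [p (y - x)], distance 0 would give [p (y - x) < p (y - x)]. *)
  have [|N [r [r0 hN]]] := ctrl [:: p] _ _ p0.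
    by move=> q; rewrite inE => /eqP ->.
  have [s s0 hs] := small N r r0.
  have := hN x y Bx By; rewrite big_seq1 ltxx => /(_ _)/negP; apply=> //.
  by apply: hs; rewrite dxy.
- by move=> x y _ _; congr sup; apply: eq_imagel => n _; rewrite /m distrC.
- move=> x y z _ _ _; apply: d_le; first by rewrite addr_ge0.
  move=> n; apply: le_trans (lerD (le_d n x y) (le_d n y z)).
  have : `|g n x - g n z| <= `|g n x - g n y| + `|g n y - g n z|.
    by apply: le_trans (ler_normD _ _); rewrite addrA subrK.
  have := normr_ge0 (g n x - g n y); have := normr_ge0 (g n y - g n z).
  have : 0 <= n.+1%:R^-1 :> R by rewrite invr_ge0 ler0n.
  rewrite /m; move: (n.+1%:R^-1) `|_| `|_| `|_| => c t u v c0 v0 u0 tuv.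
  rewrite !minEle; case: ifP; case: ifP; case: ifP; lra.
move=> x Bx; split=> [e e0|F e hF e0]; last first.
  have [N [r [r0 hN]]] := ctrl F e hF e0.
  have [s s0 hs] := small N r r0.
  by exists s => // y By dxy; apply: hN => //; exact: hs.
have e20 : 0 < e / 2 by rewrite divr_gt0.
(* From [N] on the caps keep the terms below [e / 2]; the first [N] functionals are dominated
   together by one finite sum of generators. *)
have [N Ne] := exists_inv_nat_lt e20.
have cq : cont_sn S P (fun z => \sum_(n <- iota 0 N) `|g n z|).
  by apply: cont_sn_sum => // n _; exact: dual_cont.
have [F [C [C0 [hF h]]]] := cont_sn_ge0 hP cq.
exists F, (e / 2 / (C + 1)); split=> //; split; first by rewrite !divr_gt0 //; lra.
move=> y By; rewrite ltr_pdivlMr; last by lra.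
move=> hy; apply: (@le_lt_trans _ _ (e / 2)); last by lra.
apply: d_le => [|n]; first by lra.
have [nN|nN] := ltnP n N; last first.
  rewrite ge_min; apply/orP; right; apply: ltW; apply: le_lt_trans Ne.
  by rewrite lef_pV2 ?posrE ?ltr0n // ler_nat; lia.
have Syx : S (y - x) by apply: subspaceB => //; exact: BS.
rewrite ge_min; apply/orP; left; rewrite distrC.
rewrite -(linear_onB (dual_linear (hg n))); [|exact: BS|exact: BS].
have sum0 := sum_seminorm_ge0 hP hF Syx.
have := h _ Syx; rewrite (big_rem n) /=; last by rewrite mem_iota.
have : 0 <= \sum_(k <- rem n (iota 0 N)) `|g k (y - x)| by apply: sumr_ge0.
by nra.
Qed.

End Nets.

(** * Regular (LM)-spaces *)

Section Metrizable.
Context {R : realType} {V : lmodType R}.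
Implicit Types (S B : set V) (P : set (V -> R)) (p q : V -> R) (f g : V -> R).

(** Scaling by [r / (q y + r * e)] brings [y] into the ball even where [q y = 0]; then [e] is
    arbitrary. *)
Lemma seminorm_le_of_ball S p q (r : R) : linear_subspace S ->
  seminorm_on S p -> seminorm_on S q -> 0 < r ->
  (forall y, S y -> q y < r -> p y <= 1) -> forall y, S y -> p y <= r^-1 * q y.
Proof.
move=> hS hp hq r0 h y Sy; apply/ler_addgt0Pr => e e0.
have s0 : 0 < q y + r * e by rewrite ltr_wpDl ?mulr_gt0 // hq.1.
have a0 : 0 <= r / (q y + r * e) by rewrite divr_ge0 ?ltW.
have := h ((r / (q y + r * e)) *: y) (subspaceZ _ hS Sy).
rewrite hq.2.2 // hp.2.2 // ger0_norm //.
rewrite -mulrA gtr_pMr // mulrC ltr_pdivrMr // mul1r ltrDl mulr_gt0 // => /(_ isT).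
rewrite mulrAC ler_pdivrMr // mul1r => h'.
by rewrite -(ler_pM2l r0) mulrDr mulrA divff ?gt_eqF // mul1r.
Qed.

(** The metric ball of radius [1 / (k + 1)] about 0 contains a ball of a finite sum of generators;
    [q k] adds up these sums for all [j <= k], which makes it increase with [k]. *)
Lemma metrizable_seminorms S P : lcs S P -> metrizable_subset P S ->
  exists q : nat -> V -> R, [/\ forall k, seminorm_on S (q k),
    forall k, cont_sn S P (q k),
    forall k l x, (k <= l)%N -> S x -> q k x <= q l x &
    forall p, cont_sn S P p -> exists n : nat, forall x, S x -> p x <= n%:R * q n x].
Proof.
move=> hE [d [_ [_ [_ [_ hd]]]]]; have [hS [hP _]] := hE.
have S0 := subspace0 hS; have [hd1 hd2] := hd _ S0.
have /choice[Fr hFr] k : exists Fr : seq (V -> R) * R,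
    [/\ forall p, p \in Fr.1 -> P p, 0 < Fr.2 &
    forall y, S y -> \sum_(p <- Fr.1) p (y - 0) < Fr.2 -> d 0 y < k.+1%:R^-1].
  have [|F [r [h1 [h2 h3]]]] := hd1 (k.+1%:R^-1); first by rewrite invr_gt0 ltr0n.
  by exists (F, r).
pose q k x := \sum_(p <- flatten [seq (Fr j).1 | j <- iota 0 k.+1]) p x.
have Fq k p : p \in flatten [seq (Fr j).1 | j <- iota 0 k.+1] -> P p.
  by move=> /flatten_mapP[j _]; case: (hFr j) => + _ _; exact.
have qS k : seminorm_on S (q k) by apply: seminorm_sum => p /Fq/hP.
have qle k l x : (k <= l)%N -> S x -> q k x <= q l x.
  move=> kl Sx; rewrite /q -(subnKC kl) -addSn iotaD map_cat flatten_cat [leRHS]big_cat.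
  rewrite lerDl big_seq; apply: sumr_ge0 => p /flatten_mapP[j _].
  by case: (hFr j) => + _ _ pj => /(_ _ pj)/hP[+ _]; exact.
exists q; split=> //.
  by move=> k; apply: cont_sn_sum => // p /Fq; exact: cont_sn_mem.
move=> p /(cont_sn_ge0 hP)[F [C [C0 [hF h]]]].
have [r r0 hr] := hd2 F 1 hF ltr01.
have [k kr] := exists_inv_nat_lt r0.
have [Fk rk hk] := hFr k.
have hpF : seminorm_on S (fun x => \sum_(p <- F) p x).
  by apply: seminorm_sum => s /hF/hP.
have dom := seminorm_le_of_ball hS hpF (qS k) rk.
have {}dom x : S x -> p x <= C * ((Fr k).2^-1 * q k x).
  move=> Sx; apply: le_trans (h _ Sx) _; apply: ler_wpM2l => //.
  apply: dom => // y Sy hy; have := hr y Sy; rewrite subr0 => hy'; apply: ltW; apply: hy'.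
  apply: lt_trans kr; apply: hk => //; rewrite subr0; apply: le_lt_trans hy.
  rewrite /q -addn1 iotaD map_cat flatten_cat [leRHS]big_cat /= cats0 lerDr.
  rewrite big_seq; apply: sumr_ge0 => s /flatten_mapP[j _].
  by case: (hFr j) => + _ _ pj => /(_ _ pj)/hP[+ _]; exact.
(* Monotonicity in the index lets one number replace both the index [k] and the constant. *)
pose n := maxn k (Num.bound (C * (Fr k).2^-1)).
exists n => x Sx; apply: le_trans (dom _ Sx) _; rewrite mulrA; apply: ler_pM => //.
- by rewrite mulr_ge0 // invr_ge0 ltW.
- exact: (qS k).1.
- apply: ltW; apply: lt_le_trans (archi_boundP _) _; last by rewrite ler_nat; lia.
  by rewrite mulr_ge0 // invr_ge0 ltW.
- by apply: qle => //; lia.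
Qed.

End Metrizable.

Section RegularLM.
Context {R : realType} {V : lmodType R}.
Implicit Types (S B : set V) (P : set (V -> R)) (p : V -> R) (f : V -> R).

(** The same [m] is factor and index of the seminorm, so that a single sequence of naturals encodes
    a continuity estimate on all the steps. *)
Definition LM_seminorms S P (Sn : nat -> set V) (q : nat -> nat -> V -> R) :=
  [/\ [/\ forall n, linear_subspace (Sn n), S = \bigcup_n Sn n,
       forall n k, seminorm_on (Sn n) (q n k) &
       forall n k l x, (k <= l)%N -> Sn n x -> q n k x <= q n l x],
     forall p, cont_sn S P p ->
       forall n, exists m : nat, forall x, Sn n x -> p x <= m%:R * q n m x,
     forall p, seminorm_on S p ->
       (forall n, exists m : nat, forall x, Sn n x -> p x <= m%:R * q n m x) ->
       cont_sn S P p &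
     forall B, bounded S P B -> exists n, B `<=` Sn n /\
       forall k, exists M : R, forall x, B x -> q n k x <= M].

Lemma regular_LM_seminorms S P : lcs S P -> regular_LM S P ->
  exists Sn q, LM_seminorms S P Sn q.
Proof.
move=> [hS [hP _]] [Sn [Pn [hl [hm [_ [SE [_ [cP [ind reg]]]]]]]]].
have /choice[q hq] n := metrizable_seminorms (hl n) (hm n).
have SnS n : Sn n `<=` S by rewrite SE => x Sx; exists n.
exists Sn, q; split.
- split=> //; first by move=> n; have [] := hl n.
  + by move=> n k; have [+ _ _ _] := hq n; exact.
  + by move=> n k l x; have [_ _ + _] := hq n; exact.
- move=> p cp n; have [_ _ _] := hq n; apply.
  have [_ [hPn _]] := hl n.
  apply: (cont_sn_comp hPn hP (T := id)) cp; first exact: SnS.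
  by move=> s /cP; exact.
- move=> p sp hp; apply: ind => // n; have [m hm'] := hp n.
  have [_ cq _ _] := hq n; apply: cont_sn_le hm' _.
  exact: cont_snZ.
- move=> B /reg[n [BS bB]]; exists n; split=> // k.
  have [_ cq _ _] := hq n; have [_ [hPn _]] := hl n.
  by have [M _ hM] := bounded_cont_sn hPn bB (cq k); exists M.
Qed.

(** A metrizable space is the inductive limit of the constant sequence of copies of itself. *)
Lemma metrizable_regular_LM S P : lcs S P -> metrizable_subset P S -> regular_LM S P.
Proof.
move=> hE hm; exists (fun=> S), (fun=> P); do 2!split=> //.
split; first by move=> _ x.
split; first by apply/seteqP; split=> [x Sx|x [n _ Sx//]]; exists 0%N.
split; first by move=> _ p; exact: cont_sn_mem.
split; first by move=> p Pp _; exact: cont_sn_mem.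
split; first by move=> q _; apply; exact: 0%N.
by move=> B bB; exists 0%N; split=> //; case: bB.
Qed.

(** * Resolutions built from a countable system of seminorms *)

Section Presentation.
Variables (S : set V) (P : set (V -> R)).
Variables (Sn : nat -> set V) (q : nat -> nat -> V -> R).
Hypotheses (hE : lcs S P) (hLM : LM_seminorms S P Sn q).

Let hSn n : linear_subspace (Sn n). Proof. by have [[+ _ _ _] _ _ _] := hLM; exact. Qed.
Let SE : S = \bigcup_n Sn n. Proof. by have [[_ + _ _] _ _ _] := hLM. Qed.
Let SnS n : Sn n `<=` S. Proof. by rewrite SE => x; exists n. Qed.
Let hq n k : seminorm_on (Sn n) (q n k).
Proof. by have [[_ _ + _] _ _ _] := hLM; exact. Qed.
Let qle n k l x : (k <= l)%N -> Sn n x -> q n k x <= q n l x.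
Proof. by have [[_ _ _ +] _ _ _] := hLM; exact. Qed.

Lemma LM_bounded n B : B `<=` Sn n ->
  (forall k, exists M : R, forall x, B x -> q n k x <= M) -> bounded S P B.
Proof.
move=> BS hB; split=> [x /BS/SnS//|p Pp].
have [_ /(_ _ (cont_sn_mem _ Pp) n)[m hm] _ _] := hLM.
have [M hM] := hB m; exists (m%:R * M) => x Bx.
by apply: le_trans (hm _ (BS _ Bx)) _; rewrite ler_wpM2l ?hM.
Qed.

Lemma LM_bounded_resolution : fundamental_bounded_resolution S P.
Proof.
pose A (a : nat -> nat) : set V := [set x | exists2 n, (n <= a 0%N)%N &
  Sn n x /\ forall k, q n k x <= (a k.+1)%:R].
have AB a B n : (n <= a 0%N)%N -> B `<=` Sn n ->
    (forall k x, B x -> q n k x <= (a k.+1)%:R) -> B `<=` A a.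
  by move=> na BS hB x Bx; exists n => //; split; [exact: BS|move=> k; exact: hB].
have Afund B : bounded S P B -> exists a, B `<=` A a.
  have [_ _ _ reg] := hLM; move=> /reg[n [BS /choice[M hM]]].
  exists (fun k => if k is k'.+1 then Num.bound `|M k'| else n).
  apply: AB BS _ => // k x Bx; apply: le_trans (hM k _ Bx) _.
  by apply: le_trans (ler_norm _) _; apply: ltW; exact: archi_boundP.
exists A; split; [|split; [|split=> //]].
(* Finitely many steps contribute, one bounded set each; induction adds them one by one. *)
- move=> a; have {AB Afund} : forall m, bounded S P [set x | exists2 n, (n < m)%N &
      Sn n x /\ forall k, q n k x <= (a k.+1)%:R].
    elim=> [|m IH]; first by rewrite (_ : [set x | _] = set0);
      [exact: bounded0|apply/seteqP; split=> // x []].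
    rewrite (_ : [set x | _] = [set x | Sn m x /\ forall k, q m k x <= (a k.+1)%:R] `|`
      [set x | exists2 n, (n < m)%N & Sn n x /\ forall k, q n k x <= (a k.+1)%:R]).
      apply: boundedU => //; apply: (@LM_bounded m); first by move=> x [].
      by move=> k; exists (a k.+1)%:R => x [_]; exact.
    apply/seteqP; split=> x.
      by move=> [n]; rewrite ltnS leq_eqVlt => /orP[/eqP ->|nm]; [left|right; exists n].
    by move=> [h|[n nm h]]; [exists m|exists n => //; exact: ltnW].
  by move=> /(_ (a 0%N).+1).
- move=> a b ab x [n na [Sx hx]]; exists n; first exact: leq_trans na (ab _).
  by split=> // k; apply: le_trans (hx k) _; rewrite ler_nat.
- move=> x Sx; have [a ha] := Afund _ (bounded1 P Sx); exists a; exact: ha.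
Qed.

(** The upper envelope of [H] is a seminorm continuous on every step, hence continuous for the
    inductive limit topology. *)
Lemma LM_equicontinuous (H : set (V -> R)) : H `<=` dual S P ->
  (forall n, exists m : nat, forall f x, H f -> Sn n x -> `|f x| <= m%:R * q n m x) ->
  equicontinuous_set S P H.
Proof.
move=> HD hH; have [hS _] := hE.
have hb x : S x -> exists M, forall f, H f -> `|f x| <= M.
  rewrite SE => -[n _ Sx]; have [m hm] := hH n.
  by exists (m%:R * q n m x) => f Hf; exact: hm.
apply/equicontinuousP; exists (fun x => sup [set `|f x| | f in H]).
  have [_ _ ind _] := hLM; apply: ind.
    apply: (seminorm_sup hS) => // f /HD/dual_linear; exact: seminorm_abs.
  move=> n; have [m hm] := hH n; exists m => x Sx.
  apply: sup_ler => [|_ [f Hf <-]]; last exact: hm.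
  by rewrite mulr_ge0 // (hq n m).1.
move=> f x Hf Sx; have [M hM] := hb _ Sx.
exact: (@le_seminorm_sup _ _ _ _ (fun f x => `|f x|) M).
Qed.

Let G (a : nat -> nat) : set (V -> R) := [set f | dual S P f /\
  forall n x, Sn n x -> `|f x| <= (a n)%:R * q n (a n) x].

Let G_mono a b : nn_le a b -> G a `<=` G b.
Proof.
move=> ab f [df hf]; split=> // n x Sx; apply: le_trans (hf _ _ Sx) _.
by apply: ler_pM; rewrite ?ler_nat ?qle ?ler0n // (hq _ _).1.
Qed.

Let G_equicontinuous a : equicontinuous_set S P (G a).
Proof.
by apply: LM_equicontinuous => [f []//|n]; exists (a n) => f x [_]; exact.
Qed.

Lemma LM_class_G : class_G S P.
Proof.
exists G; split; [by move=> a f []|split=> //; split].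
- move=> f df; have [_ hc _ _] := hLM.
  by have /choice[a ha] := hc _ (dual_cont df); exists a.
- move=> a u hu; have /equicontinuousP[p cp hp] := G_equicontinuous a.
  by apply/equicontinuousP; exists p => // _ x [n _ <-]; exact: hp.
Qed.

(* Otherwise there are [f k] in [H] and [y k] in [Sn n] with
   [q n k (y k) < 1] and [`|f k (y k)| = k + 1]; the [y k] form a bounded set. *)
Lemma LM_strongly_bounded (H : set (V -> R)) : H `<=` dual S P ->
  strongly_bounded S P H -> exists a, H `<=` G a.
Proof.
move=> HD hH.
suff /choice[a ha] n : exists m : nat, forall f, H f ->
    forall x, Sn n x -> `|f x| <= m%:R * q n m x.
  by exists a => f Hf; split=> [|n x Sx]; [exact: HD|exact: ha].
apply: contrapT => /forallNP nm.
have /choice[y hy] k : exists y, [/\ Sn n y, q n k y < 1 &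
    exists2 f, H f & `|f y| = k%:R + 1].
  have := nm k.+1 => /existsNP[f /not_implyP[Hf /existsNP[x /not_implyP[Sx /negP]]]].
  rewrite -ltNge => hx.
  have q0 : 0 <= q n k.+1 x by exact: (hq n k.+1).1.
  have fx0 : 0 < `|f x| by apply: le_lt_trans hx; rewrite mulr_ge0.
  have c0 : 0 <= k.+1%:R / `|f x| by rewrite divr_ge0.
  (* Normalizing the value of [f] to [k + 1] turns [hx] into a bound by 1 for [q n k.+1], hence for
     the smaller [q n k]. *)
  exists ((k.+1%:R / `|f x|) *: x); split; first exact: subspaceZ.
    rewrite (hq n k).2.2 // ger0_norm //.
    apply: le_lt_trans (ler_wpM2l c0 (qle (leqnSn k) Sx)) _.
    by rewrite mulrAC ltr_pdivrMr // mul1r.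
  exists f => //; rewrite (linear_onZ _ hE.1 (dual_linear (HD _ Hf))); last exact: SnS Sx.
  by rewrite normrM (ger0_norm c0) divfK ?gt_eqF // natr1.
have bB : bounded S P (range y).
  apply: (@LM_bounded n); first by move=> _ [k _ <-]; have [] := hy k.
  (* For [j >= k], [q n k] is below [q n j], which is less than 1 at [y j]; the sum takes care of
     the finitely many earlier points. *)
  move=> k; exists (1 + \sum_(j < k) q n k (y j)) => _ [j _ <-].
  have s0 : 0 <= \sum_(j < k) q n k (y j).
    by apply: sumr_ge0 => i _; apply: (hq n k).1; have [] := hy i.
  have [Sy qy _] := hy j; have [jk|kj] := ltnP j k; last first.
    by apply: le_trans (qle kj Sy) _; lra.
  rewrite (bigD1 (Ordinal jk)) //=.
  suff : 0 <= \sum_(i < k | i != Ordinal jk) q n k (y i) by lra.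
  by apply: sumr_ge0 => i _; apply: (hq n k).1; have [] := hy i.
have [M hM] := hH _ bB.
pose k := Num.bound `|M|; have [_ _ [f Hf fk]] := hy k.
have := hM f (y k) Hf (ex_intro2 _ _ k I erefl); rewrite fk.
have := ler_norm M; have := archi_boundP (normr_ge0 M); rewrite -/k; lra.
Qed.

Lemma LM_strongly_bounded_resolution : exists A : (nat -> nat) -> set (V -> R),
  [/\ forall a, A a `<=` dual S P, forall a, equicontinuous_set S P (A a),
    forall a b, nn_le a b -> A a `<=` A b &
    forall H, H `<=` dual S P -> strongly_bounded S P H -> exists a, H `<=` A a].
Proof. by exists G; split=> // [a f []//|]; exact: LM_strongly_bounded. Qed.

End Presentation.

Lemma regular_LM_quasi_DF S P : lcs S P -> regular_LM S P -> quasi_DF S P.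
Proof.
move=> hE /(regular_LM_seminorms hE)[Sn [q hLM]]; split=> //.
by split; [exact: LM_bounded_resolution hLM|exact: LM_class_G hLM].
Qed.

(* Kolmogorov's criterion: if no ball [q n < 1/(n+1)] lay in the [n]-th member of a
   fundamental sequence of bounded sets, points [x n] of the difference would form a
   bounded null sequence contained in no member. *)
Lemma metrizable_DF_normable S P :
  lcs S P -> metrizable_subset P S -> DF S P -> normable S P.
Proof.
move=> hE hm [_ [[Bs [bBs fBs]] _]]; have [hS [hP sep]] := hE.
have [q [qS qc qle qdom]] := metrizable_seminorms hE hm.
have [n hn] : exists n, [set x | S x /\ q n x < n.+1%:R^-1] `<=` Bs n.
  apply: contrapT => /forallNP nn.
  have /choice[x hx] n : exists x, [/\ S x, q n x < n.+1%:R^-1 & ~ Bs n x].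
    by have /existsNP[x /not_implyP[[Sx qx] nB]] := nn n; exists x.
  have [|m xm] := fBs (range x); last first.
    by have [_ _] := hx m; apply; apply: xm; exists m.
  split; first by move=> _ [k _ <-]; have [] := hx k.
  move=> p /(cont_sn_mem S)/qdom[m pm].
  (* From [m] on, [p (x j)] is at most [m] times [q j (x j)], which is less than 1; the sum covers
     the terms before. *)
  exists (m%:R + \sum_(j < m) `|p (x j)|) => _ [j _ <-].
  have [Sx qx _] := hx j; have [jm|mj] := ltnP j m.
    rewrite (bigD1 (Ordinal jm)) //=.
    have : 0 <= \sum_(i < m | i != Ordinal jm) `|p (x i)| by apply: sumr_ge0.
    have := ler_norm (p (x j)); have := ler0n R m; lra.
  have : 0 <= \sum_(i < m) `|p (x i)| by apply: sumr_ge0.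
  suff : p (x j) <= m%:R by lra.
  apply: le_trans (pm _ Sx) _; rewrite ler_piMr //.
  apply: le_trans (qle _ _ _ mj Sx) _; apply: ltW; apply: lt_le_trans qx _.
  by rewrite invf_le1 ?ltr0n // ler1n.
have r0 : 0 < n.+1%:R^-1 :> R by rewrite invr_gt0 ltr0n.
(* The ball of [q n] is bounded, so [p] stays below [M + 1] on it, and homogeneity turns this into a
   multiple of [q n]. *)
have dom p : P p -> exists2 C : R, 0 <= C & forall x, S x -> p x <= C * q n x.
  move=> Pp; have [M M0 hM] := bounded_cont_sn hP (bBs n) (cont_sn_mem S Pp).
  have M1 : 0 < M + 1 by lra.
  have [hp0 [hpD hpZ]] := hP _ Pp.
  have hp' : seminorm_on S (fun x => (M + 1)^-1 * p x).
    have i0 : 0 <= (M + 1)^-1 by rewrite invr_ge0 ltW.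
    split=> [x Sx|]; first by rewrite mulr_ge0 ?hp0.
    split=> [x y Sx Sy|a x Sx]; last by rewrite hpZ // mulrCA.
    by rewrite -mulrDr ler_wpM2l ?hpD.
  have h := seminorm_le_of_ball hS hp' (qS n) r0.
  exists ((M + 1) * n.+1%:R^-1^-1); first by rewrite mulr_ge0 ?invrK // ltW.
  move=> x Sx; rewrite -mulrA -ler_pdivrMl //; apply: h => // y Sy qy.
  rewrite ler_pdivrMl // mulr1; have := hM y (hn _ (conj Sy qy)); lra.
exists (q n); do 2!split=> //.
  move=> x Sx qx; apply: contrapT => x0; have [p Pp] := sep _ Sx x0; apply.
  have [C C0 hC] := dom _ Pp; apply/eqP; rewrite eq_le (hP _ Pp).1 // andbT.
  by have := hC _ Sx; rewrite qx mulr0.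
split=> // p /dom[C C0 hC].
apply: cont_sn_le hC _; exists [:: q n], C; split; last by move=> x _; rewrite big_seq1.
by move=> p'; rewrite inE => /eqP ->.
Qed.

End RegularLM.

(** * Strong duals *)

Section StrongDual.
Context {R : realType} {V : lmodType R}.
Variables (S : set V) (P : set (V -> R)).
Hypothesis hE : lcs S P.

Let hP : forall p, P p -> seminorm_on S p. Proof. by have [_ []] := hE. Qed.

(** [R^o], the line as a module over itself, equips the functions on [V] with their pointwise vector
    space structure. *)
Local Notation E' := (dual S P : set (V -> R^o)).
Local Notation P' := (strong_dual_sn S P : set ((V -> R^o) -> R)).

Lemma dual_subspace : @linear_subspace R (V -> R^o) E'.
Proof.
have addE (f g : V -> R^o) x : (f + g) x = (f x : R) + g x by [].
have scaleE a (f : V -> R^o) x : (a *: f) x = a * (f x : R) by [].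
split; [exact: dual0|split].
- move=> f g [f0 [lf cf]] [g0 [lg cg]]; split; [|split].
  + by move=> x Sx; rewrite addE f0 // g0 // addr0.
  + move=> a x y Sx Sy; rewrite !addE lf // lg //.
    by rewrite mulrDr addrACA.
  + apply: cont_sn_le (cont_snD hP cf cg) => x _; exact: ler_normD.
- move=> a f [f0 [lf cf]]; split; [|split].
  + by move=> x Sx; rewrite scaleE f0 // mulr0.
  + move=> b x y Sx Sy; rewrite !scaleE lf //.
    by rewrite mulrDr !mulrA (mulrC a b).
  + apply: cont_sn_le (cont_snZ (normr_ge0 a) cf) => x _.
    by rewrite scaleE normrM.
Qed.

Lemma dual_le_sup (B : set V) f x : bounded S P B -> E' f -> B x ->
  `|f x| <= sup [set `|f x| | x in B].
Proof.
by move=> bB /dual_cont cf Bx; exact: (bounded_sup_ge hP bB cf).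
Qed.

Lemma dual_sup_mono (B B' : set V) f : B `<=` B' -> bounded S P B' -> E' f ->
  sup [set `|f x| | x in B] <= sup [set `|f x| | x in B'].
Proof.
move=> BB' bB' df; apply: sup_ler => [|_ [x /BB' Bx <-]].
  by apply: sup_ger0 => _ [x _ <-].
exact: dual_le_sup.
Qed.

Lemma strong_dual_seminorm q : P' q -> seminorm_on E' q.
Proof.
move=> [B bB ->].
apply: (@seminorm_sup _ (V -> R^o) V B (fun x f => `|f x|)).
- exact: dual_subspace.
- move=> x Bx; split=> //; split=> [f g _ _|a f _]; first exact: ler_normD.
  by rewrite -normrM.
- move=> f /dual_cont cf; have [M _ hM] := bounded_cont_sn hP bB cf.
  by exists M.
Qed.

Lemma strong_dual_lcs : @lcs R (V -> R^o) E' P'.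
Proof.
split; [exact: dual_subspace|split; first exact: strong_dual_seminorm].
move=> f df fn0; have /existsNP[x fx] : ~ forall x, f x = 0.
  by move=> f0; apply: fn0; apply/funext.
(* Members of the dual are normalized to vanish outside [S], so [x] is a point of the space and its
   singleton gives the separating seminorm. *)
have Sx : S x by apply: contrapT => /(df.1).
exists (fun f => sup [set `|f x| | x in [set x]]).
  by exists [set x] => //; exact: bounded1.
move=> s0; have := dual_le_sup (bounded1 P Sx) df erefl.
by rewrite s0 normr_le0 => /eqP.
Qed.

Lemma strong_dual_bounded (H : set (V -> R^o)) :
  bounded E' P' H <-> H `<=` E' /\ strongly_bounded S P H.
Proof.
split=> [[HD hH]|[HD hH]]; split=> //.
- move=> B bB; have [|M hM] := hH (fun f => sup [set `|f x| | x in B]).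
    by exists B.
  exists M => f x Hf Bx; apply: le_trans (hM _ Hf).
  by apply: dual_le_sup => //; exact: HD.
- move=> _ [B bB ->]; have [M hM] := hH _ bB.
  exists `|M| => f Hf; apply: sup_ler => // _ [x Bx <-].
  exact: le_trans (hM _ _ Hf Bx) (ler_norm _).
Qed.

Lemma equicontinuous_strongly_bounded (H : set (V -> R)) :
  equicontinuous_set S P H -> strongly_bounded S P H.
Proof.
move=> /equicontinuousP[q cq hq] B bB; have [M _ hM] := bounded_cont_sn hP bB cq.
exists M => f x Hf Bx; apply: le_trans (hM _ Bx); apply: hq => //; exact: bB.1.
Qed.

(** Finitely many bounded sets are absorbed into their union, so one strong seminorm suffices; the
    integer factor is what an index can store. *)
Lemma strong_dual_cont (q : (V -> R^o) -> R) : cont_sn E' P' q ->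
  exists (B : set V) (n : nat), bounded S P B /\
    forall f, E' f -> q f <= n%:R * sup [set `|f x| | x in B].
Proof.
move=> /(cont_sn_ge0 strong_dual_seminorm)[F [C [C0 [hF h]]]].
have [B [bB hB]] : exists B, bounded S P B /\ forall s, s \in F ->
    forall f, E' f -> s f <= sup [set `|f x| | x in B].
  elim: F hF {h} => [|s F IH] hF; first by exists set0; split=> //; exact: bounded0.
  have [|B [bB hB]] := IH; first by move=> t tF; apply: hF; rewrite inE tF orbT.
  have [D bD sE] := hF s (mem_head _ _).
  have bU : bounded S P (D `|` B) by exact: boundedU.
  exists (D `|` B); split=> // t; rewrite inE => /orP[/eqP ->|tF] f df.
    by rewrite sE; apply: dual_sup_mono => // x; left.
  by apply: le_trans (hB _ tF _ df) _; apply: dual_sup_mono => // x; right.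
exists B, (Num.bound (C * (size F)%:R)); split=> // f df.
have s0 : 0 <= sup [set `|f x| | x in B] by apply: sup_ger0 => _ [x _ <-].
apply: le_trans (h _ df) _.
apply: (@le_trans _ _ (C * ((size F)%:R * sup [set `|f x| | x in B]))).
  apply: ler_wpM2l => //; elim: F hF {h} hB => [|s F IH] hF hB.
    by rewrite big_nil mul0r.
  rewrite big_cons /= -nat1r mulrDl mul1r lerD ?hB ?mem_head //.
  apply: IH => [t tF|t tF]; [apply: hF|apply: hB]; by rewrite inE tF orbT.
rewrite mulrA ler_wpM2r //; apply: ltW; apply: archi_boundP.
by rewrite mulr_ge0.
Qed.

(** The entry [a 0] is a factor and the shifted index selects a bounded set. Each member is thus
    dominated by a multiple of a single strong seminorm, and [strong_dual_cont] shows that the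
    members cover. *)
Lemma strong_dual_class_G : fundamental_bounded_resolution S P ->
  class_G E' P'.
Proof.
move=> [A [Ab [Amono [_ Afund]]]].
pose A' (a : nat -> nat) : set ((V -> R^o) -> R) := [set phi | dual E' P' phi /\
  forall f, E' f -> `|phi f| <= (a 0%N)%:R * sup [set `|f x| | x in A (a \o succn)]].
exists A'; split; [by move=> a phi []|split; [|split]].
- move=> a b ab phi [dphi hphi]; split=> // f df.
  apply: le_trans (hphi _ df) _; apply: ler_pM => //.
  + by apply: sup_ger0 => _ [x _ <-].
  + by rewrite ler_nat.
  + by apply: dual_sup_mono => //; apply: Amono => n; exact: ab.
- move=> phi dphi; have [B [n [bB hn]]] := strong_dual_cont (dual_cont dphi).
  have [b Bb] := Afund _ bB; exists (fun k => if k is k'.+1 then b k' else n).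
  split=> // f df /=; apply: le_trans (hn _ df) _; rewrite ler_wpM2l //.
  exact: dual_sup_mono.
- move=> a u hu; apply/equicontinuousP.
  exists (fun f => (a 0%N)%:R * sup [set `|f x| | x in A (a \o succn)]).
    by apply: cont_snZ => //; apply: cont_sn_mem; exists (A (a \o succn)).
  by move=> _ f [n _ <-] df; exact: (hu n).2.
Qed.

Lemma strong_dual_quasi_DF : regular_LM S P -> @quasi_DF R (V -> R^o) E' P'.
Proof.
move=> hLM; have [_ [bres _]] := regular_LM_quasi_DF hE hLM.
have [Sn [q hq]] := regular_LM_seminorms hE hLM.
split; [exact: strong_dual_lcs|split; last exact: strong_dual_class_G].
have [A [AD Aeq Amono Afund]] := LM_strongly_bounded_resolution hE hq.
exists A; split; [|split=> //; split].
- move=> a; apply/strong_dual_bounded; split=> //.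
  exact: equicontinuous_strongly_bounded.
- move=> f df; have [||a ha] := Afund [set f]; last by exists a; exact: ha.
    by move=> _ ->.
  move=> B bB; have [M _ hM] := bounded_cont_sn hP bB (dual_cont df).
  by exists M => _ x -> /hM.
- by move=> H /strong_dual_bounded[]; exact: Afund.
Qed.

End StrongDual.

(** * Countable sums and products *)

Lemma dep_choice (I : Type) (T : I -> Type) (Q : forall i, T i -> Prop) :
  (forall i, exists x, Q i x) -> exists f : forall i, T i, forall i, Q i (f i).
Proof. by move=> h; exists (fun i => sval (cid (h i))) => i; case: cid. Qed.

(** * Coding countably many indices into one *)

Section Coding.
Context {I : countType}.

(** The entry [a 0] is set aside for a bound on the relevant coordinates; the remaining entries hold
    one sequence for each [i]. *)
Definition split_index (a : nat -> nat) (i : I) : nat -> nat :=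
  fun k => a (pickle (i, k)).+1.

Lemma split_index_le a b i : nn_le a b -> nn_le (split_index a i) (split_index b i).
Proof. by move=> ab k; exact: ab. Qed.

Lemma join_index (n : nat) (b : I -> nat -> nat) : exists2 a, a 0%N = n &
  forall i, split_index a i = b i.
Proof.
exists (fun m => if m is m'.+1 then
  if @unpickle (I * nat)%type m' is Some (i, k) then b i k else 0%N else n) => // i.
by apply/funext => k; rewrite /split_index pickleK.
Qed.

(** [unpickle] may send several numbers to one index, hence [undup], and may also yield indices
    whose code is [n] or more. *)
Definition indices_below (n : nat) : seq I := undup (pmap unpickle (iota 0 n)).

Lemma mem_indices_below n i : (pickle i < n)%N -> i \in indices_below n.
Proof.
move=> h; rewrite mem_undup mem_pmap; apply/mapP; exists (pickle i).
  by rewrite mem_iota.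
by rewrite pickleK.
Qed.

End Coding.

(** * Coordinates, direct sums and products *)

Section DirectProducts.
Context {R : realType} {I : countType} {V : I -> lmodType R}.
Variables (S : forall i, set (V i)) (P : forall i, set (V i -> R)).
Implicit Types (x y : dprod V).

Definition coord_inj (i : I) (v : V i) : dprod V := dfwith (fun=> 0) i v.

Lemma coord_inj_in i (v : V i) : coord_inj v i = v.
Proof. exact: dfwithin. Qed.

Lemma coord_inj_out i j (v : V i) : j <> i -> coord_inj v j = 0.
Proof. by move=> ji; apply: dfwithout; apply/eqP => /esym. Qed.

Lemma dprodP x y : (forall i, x i = y i) -> x = y.
Proof. exact: functional_extensionality_dep. Qed.

Lemma dprod_addE x y i : (x + y) i = x i + y i. Proof. by []. Qed.
Lemma dprod_subE x y i : (x - y) i = x i - y i. Proof. by []. Qed.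
Lemma dprod_scaleE (a : R) x i : (a *: x) i = a *: x i. Proof. by []. Qed.

Lemma coord_inj_linear i (a : R) (v w : V i) :
  coord_inj (a *: v + w) = a *: coord_inj v + coord_inj w.
Proof.
apply: dprodP => j; rewrite dprod_addE dprod_scaleE.
have [<-|ij] := eqVneq i j; first by rewrite !coord_inj_in.
by rewrite !coord_inj_out ?scaler0 ?addr0 //; apply/eqP; rewrite eq_sym.
Qed.

Lemma dprod_sumE (T : Type) (s : seq T) (x : T -> dprod V) i :
  (\sum_(t <- s) x t) i = \sum_(t <- s) x t i.
Proof. by elim: s => [|t s IH]; rewrite ?big_nil // !big_cons dprod_addE IH. Qed.

Lemma sum_coord_inj n x i : (pickle i < n)%N ->
  (\sum_(j <- indices_below n) coord_inj (x j)) i = x i.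
Proof.
move=> h; rewrite dprod_sumE (bigD1_seq i) ?undup_uniq ?mem_indices_below //=.
rewrite coord_inj_in big1 ?addr0 // => j ji.
by rewrite coord_inj_out //; apply/eqP; rewrite eq_sym.
Qed.

Lemma dprod_finite_decomp n x : (forall i, (n <= pickle i)%N -> x i = 0) ->
  x = \sum_(i <- indices_below n) coord_inj (x i).
Proof.
move=> x0; apply: dprodP => i; have [h|h] := ltnP (pickle i) n.
  by rewrite sum_coord_inj.
rewrite x0 // dprod_sumE big1 // => j _.
have [ji|ji] := eqVneq j i; last by rewrite coord_inj_out //; apply/eqP; rewrite eq_sym.
by rewrite -ji coord_inj_in ji x0.
Qed.

(** Finite support becomes a bound on codes, a number that an index can store. *)
Lemma dsum_SP x : dsum_S S x <->
  (forall i, S (x i)) /\ exists n, forall i, (n <= pickle i)%N -> x i = 0.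
Proof.
split=> [[Sx /finite_seqP[s sE]]|[Sx [n hn]]]; split=> //.
  exists (\max_(i <- s) (pickle i).+1) => i hi; apply: contrapT => xi.
  have : i \in s by have : [set i | x i <> 0] i by []; rewrite sE.
  move=> si; have := @leq_bigmax_seq _ s xpredT (fun i => (pickle i).+1) i si isT; lia.
apply: sub_finite_set (finite_seq (indices_below n)) => i xi.
by apply: mem_indices_below; rewrite ltnNge; apply/negP => /hn.
Qed.

Section Spaces.
Hypothesis hE : forall i, lcs (@S i) (@P i).

Let hS i : linear_subspace (@S i). Proof. by have [] := hE i. Qed.
Let hP i p : P p -> seminorm_on (@S i) p.
Proof. by have [_ [+ _]] := hE i; exact. Qed.

Lemma coord_inj_S i (v : V i) j : S v -> S (coord_inj v j).
Proof.
move=> Sv; have [<-|ij] := eqVneq i j; first by rewrite coord_inj_in.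
by rewrite coord_inj_out; [exact: subspace0|apply/eqP; rewrite eq_sym].
Qed.

Lemma coord_inj_dsum i (v : V i) : S v -> dsum_S S (coord_inj v).
Proof.
move=> Sv; apply/dsum_SP; split; first by move=> j; exact: coord_inj_S.
exists (pickle i).+1 => j ij; apply: coord_inj_out => ji.
by rewrite ji ltnn in ij.
Qed.

Lemma dsum_sub_prod : dsum_S S `<=` prod_S S. Proof. by move=> x []. Qed.

Lemma prod_subspace : linear_subspace (prod_S S).
Proof.
split; [|split].
- by move=> i; exact: subspace0.
- by move=> x y Sx Sy i; exact: subspaceD (Sx i) (Sy i).
- by move=> a x Sx i; exact: subspaceZ (Sx i).
Qed.

Lemma dsum_subspace : linear_subspace (dsum_S S).
Proof.
split; [|split].
- apply/dsum_SP; split; last by exists 0%N.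
  exact: subspace0 prod_subspace.
- move=> x y /dsum_SP[Sx [n hn]] /dsum_SP[Sy [m hm]]; apply/dsum_SP.
  split; first exact: subspaceD prod_subspace Sx Sy.
  exists (maxn n m) => i hi; rewrite dprod_addE hn ?hm ?addr0 //; lia.
- move=> a x /dsum_SP[Sx [n hn]]; apply/dsum_SP.
  split; first exact: subspaceZ prod_subspace Sx.
  by exists n => i /hn xi; rewrite dprod_scaleE xi scaler0.
Qed.

Lemma seminorm_coord T i (p : V i -> R) : T `<=` prod_S S ->
  seminorm_on (@S i) p -> seminorm_on T (fun x => p (x i)).
Proof.
move=> TS [p0 [pD pZ]]; split; first by move=> x /TS Sx; exact: p0.
split; first by move=> x y /TS Sx /TS Sy; exact: pD.
by move=> a x /TS Sx; exact: pZ.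
Qed.

Lemma cont_sn_coord_inj i j (p : V i -> R) : P p ->
  cont_sn (@S j) (@P j) (fun v => p (coord_inj v i)).
Proof.
move=> Pp; have [ij|ij] := eqVneq i j.
  subst j; apply: cont_sn_le (cont_sn_mem _ Pp) => v _.
  by rewrite coord_inj_in.
apply: cont_sn_le (cont_sn0 _ _) => v _.
by rewrite coord_inj_out ?(seminorm_on0 (hS i) (hP Pp)) //; apply/eqP.
Qed.

(** A point supported at [i] is the image of its coordinate, so the defining condition becomes
    continuity along the embeddings, in terms of [cont_sn]. *)
Lemma dsum_PP (q : dprod V -> R) : dsum_P S P q <->
  seminorm_on (dsum_S S) q /\
  forall i, cont_sn (@S i) (@P i) (fun v => q (coord_inj v)).
Proof.
split=> [] [sq cq]; split=> // i; have [F [C [hF h]]] := cq i; exists F, C; split=> //.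
  move=> v Sv; have := h (coord_inj v) (coord_inj_dsum Sv).
  by rewrite coord_inj_in; apply=> j; exact: coord_inj_out.
move=> x Sx xi; have -> : x = coord_inj (x i).
  apply: dprodP => j; have [<-|ij] := eqVneq i j; first by rewrite coord_inj_in.
  by rewrite xi ?coord_inj_out //; apply/eqP; rewrite eq_sym.
by rewrite coord_inj_in; apply: h; exact: dsum_sub_prod Sx i.
Qed.

Lemma dsum_coord_P i (p : V i -> R) : P p -> dsum_P S P (fun x => p (x i)).
Proof.
move=> Pp; apply/dsum_PP; split.
  exact: seminorm_coord dsum_sub_prod (hP Pp).
by move=> j; exact: cont_sn_coord_inj.
Qed.

(** Finite support makes the supremum finite, and on each summand it reduces to [s i]. This yields
    one generator that controls all coordinates at once. *)
Lemma dsum_sup_P (s : forall i, V i -> R) :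
  (forall i, seminorm_on (@S i) (s i)) -> (forall i, cont_sn (@S i) (@P i) (s i)) ->
  dsum_P S P (fun x => sup [set s i (x i) | i in [set: I]]) /\
  forall x i, dsum_S S x -> s i (x i) <= sup [set s i (x i) | i in [set: I]].
Proof.
move=> hs cs.
have bnd x : dsum_S S x -> exists M, forall i, [set: I] i -> s i (x i) <= M.
  move=> /dsum_SP[Sx [n hn]]; exists (\sum_(j <- indices_below n) s j (x j)) => i _.
  have sp : forall r : seq I, 0 <= \sum_(j <- r) s j (x j).
    by move=> r; apply: sumr_ge0 => j _; apply: (hs j).1; exact: Sx.
  have [h|h] := ltnP (pickle i) n; last by rewrite hn // (seminorm_on0 (hS i) (hs i)).
  rewrite (big_rem i) ?mem_indices_below //= lerDl; exact: sp.
have le_s x i : dsum_S S x -> s i (x i) <= sup [set s i (x i) | i in [set: I]].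
  move=> /bnd[M hM]; apply: (@le_supr _ _ M); last by exists i.
  by move=> _ [j Ij <-]; exact: hM.
split=> //; apply/dsum_PP; split.
  apply: (seminorm_sup dsum_subspace (q := fun i x => s i (x i))) => // i _.
  exact: seminorm_coord dsum_sub_prod (hs i).
move=> i; apply: cont_sn_le (cs i) => v Sv; apply: sup_ler; first exact: (hs i).1.
move=> _ [j _ <-]; have [ij|ij] := eqVneq j i.
  by subst j; rewrite coord_inj_in.
rewrite coord_inj_out; last exact/eqP.
by rewrite (seminorm_on0 (hS j) (hs j)) (hs i).1.
Qed.

Lemma dsum_seminorm_le (q : dprod V -> R) n x : seminorm_on (dsum_S S) q ->
  dsum_S S x -> (forall i, (n <= pickle i)%N -> x i = 0) ->
  q x <= \sum_(i <- indices_below n) q (coord_inj (x i)).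
Proof.
move=> sq Sx /dprod_finite_decomp {1}->.
apply: (seminorm_le_sum _ dsum_subspace sq).
by move=> i; apply: coord_inj_dsum; exact: dsum_sub_prod Sx i.
Qed.

Lemma dsum_lcs : lcs (dsum_S S) (dsum_P S P).
Proof.
split; [exact: dsum_subspace|split; first by move=> p []].
move=> x Sx x0; have /existsNP[i xi] : ~ forall i, x i = 0.
  by move=> h; apply: x0; exact: dprodP.
have [_ [_ sep]] := hE i; have [p Pp pxi] := sep _ (dsum_sub_prod Sx i) xi.
by exists (fun x => p (x i)) => //; exact: dsum_coord_P.
Qed.

Lemma prod_seminorm p : prod_P P p -> seminorm_on (prod_S S) p.
Proof. by move=> [i [q Pq ->]]; exact: seminorm_coord (hP Pq). Qed.

Lemma prod_lcs : lcs (prod_S S) (prod_P P).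
Proof.
split; [exact: prod_subspace|split; first exact: prod_seminorm].
move=> x Sx x0; have /existsNP[i xi] : ~ forall i, x i = 0.
  by move=> h; apply: x0; exact: dprodP.
have [_ [_ sep]] := hE i; have [p Pp pxi] := sep _ (Sx i) xi.
by exists (fun x => p (x i)) => //; exists i, p.
Qed.

(** A set is bounded in the product when its projections are, so boxes of members suffice. *)
Lemma prod_bounded_resolution :
  (forall i, fundamental_bounded_resolution (@S i) (@P i)) ->
  fundamental_bounded_resolution (prod_S S) (prod_P P).
Proof.
move=> /dep_choice[A hA]; have Ab i := (hA i).1; have Am i := (hA i).2.1.
have Ac i := (hA i).2.2.1; have Af i := (hA i).2.2.2.
exists (fun a => [set x : dprod V | forall i, A i (split_index a i) (x i)]).
split; [|split; [|split]].
- move=> a; split=> [x hx i|_ [i [p Pp ->]]]; first exact: (Ab i _).1 (hx i).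
  by have [M hM] := (Ab i (split_index a i)).2 _ Pp; exists M => x hx; exact: hM.
- by move=> a b ab x hx i; apply: Am (hx i); exact: split_index_le.
- move=> x Sx; have /choice[b hb] i := Ac i _ (Sx i).
  have [a _ ha] := join_index 0 b; exists a => i; rewrite ha; exact: hb.
- move=> B [BS hB].
  have /choice[b hb] i : exists b, [set x i | x in B] `<=` A i b.
    apply: Af; split=> [_ [x Bx <-]|p Pp]; first exact: BS Bx i.
    have [|M hM] := hB (fun x => p (x i)); first by exists i, p.
    by exists M => _ [x Bx <-]; exact: hM.
  have [a _ ha] := join_index 0 b; exists a => x Bx i; rewrite ha.
  by apply: hb; exists x.
Qed.

(** The members are boxes cut down to the coordinates of code below [a 0]. *)
Lemma dsum_bounded_resolution :
  (forall i, fundamental_bounded_resolution (@S i) (@P i)) ->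
  fundamental_bounded_resolution (dsum_S S) (dsum_P S P).
Proof.
move=> /dep_choice[A hA]; have Ab i := (hA i).1; have Am i := (hA i).2.1.
have Ac i := (hA i).2.2.1; have Af i := (hA i).2.2.2.
exists (fun a => [set x : dprod V | dsum_S S x /\
  (forall i, (a 0%N <= pickle i)%N -> x i = 0) /\
  forall i, A i (split_index a i) (x i)]).
split; [|split; [|split]].
- move=> a; split=> [x []//|q Pq].
  have [sq /dep_choice[M hM]] : seminorm_on (dsum_S S) q /\ forall i, exists M,
      forall v, A i (split_index a i) v -> q (coord_inj v) <= M.
    have [sq cq] := (dsum_PP q).1 Pq; split=> // i.
    have [M _ hM] := bounded_cont_sn (@hP i) (Ab i (split_index a i)) (cq i).
    by exists M.
  exists (\sum_(i <- indices_below (a 0%N)) M i) => x [Sx [x0 hx]].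
  apply: le_trans (dsum_seminorm_le sq Sx x0) _.
  by apply: ler_sum => i _; exact: hM.
- move=> a b ab x [Sx [x0 hx]]; split=> //; split=> i.
    by move=> hi; apply: x0; exact: leq_trans (ab _) hi.
  by apply: Am (hx i); exact: split_index_le.
- move=> x Sx; have /dsum_SP[_ [n hn]] := Sx.
  have /choice[b hb] i := Ac i _ (dsum_sub_prod Sx i).
  have [a a0 ha] := join_index n b; exists a; split=> //; split.
    by rewrite a0.
  by move=> i; rewrite ha; exact: hb.
- move=> B [BS hB].
  have /choice[b hb] i : exists b, [set x i | x in B] `<=` A i b.
    apply: Af; split=> [_ [x Bx <-]|p Pp]; first exact: dsum_sub_prod (BS _ Bx) i.
    have [M hM] := hB _ (dsum_coord_P Pp).
    by exists M => _ [x Bx <-]; exact: hM.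
  suff [n hn] : exists n, forall x, B x -> forall i, (n <= pickle i)%N -> x i = 0.
    have [a a0 ha] := join_index n b; exists a => x Bx; split; first exact: BS.
    split; first by rewrite a0; exact: hn.
    by move=> i; rewrite ha; apply: hb; exists x.
  (* Wherever [B] has a nonzero [i]-th coordinate, [s i] is scaled to reach [pickle i] at a point of
     [B]. The supremum of the [s i] is bounded on [B], so the codes of such [i] are bounded. *)
  have /dep_choice[s hs] i : exists s : V i -> R, [/\ seminorm_on (@S i) s,
      cont_sn (@S i) (@P i) s &
      (exists2 x, B x & x i <> 0) -> exists2 x, B x & (pickle i)%:R <= s (x i)].
    have [[x Bx xi]|nx] := pselect (exists2 x, B x & x i <> 0); last first.
      exists (fun=> 0); split=> //; last exact: cont_sn0.
      by split=> //; split=> [*|*]; rewrite ?addr0 ?mulr0.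
    have Sx := dsum_sub_prod (BS _ Bx) i.
    have [_ [_ sep]] := hE i; have [p Pp /eqP pxi] := sep _ Sx xi.
    have [p0 [pD pZ]] := hP Pp.
    have c0 : 0 <= (pickle i)%:R / p (x i) by rewrite divr_ge0 // p0.
    exists (fun v => (pickle i)%:R / p (x i) * p v); split.
    + split; first by move=> v Sv; rewrite mulr_ge0 // p0.
      split=> [v w Sv Sw|c v Sv]; last by rewrite pZ // mulrCA.
      by rewrite -mulrDr ler_wpM2l // pD.
    + by apply: cont_snZ => //; exact: cont_sn_mem.
    + by move=> _; exists x => //; rewrite divfK.
  have [|i|sP sle] := @dsum_sup_P s; [by move=> i; have [] := hs i|by have [] := hs i|].
  have [M hM] := hB _ sP; exists (Num.bound `|M|) => x Bx i hi; apply: contrapT => xi.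
  have [_ _ []] := hs i; first by exists x.
  move=> y By; apply/negP; rewrite -ltNge.
  apply: le_lt_trans (sle y i (BS _ By)) _; apply: le_lt_trans (hM _ By) _.
  apply: le_lt_trans (ler_norm _) _; apply: lt_le_trans (archi_boundP _) _ => //.
  by rewrite ler_nat.
Qed.

(** [T] and [Q] are left abstract to serve both the sum and the product. *)
Lemma dual_coord_inj (T : set (dprod V)) (Q : set (dprod V -> R)) i f :
  (forall p, Q p -> seminorm_on T p) ->
  (forall v : V i, S v <-> T (coord_inj v)) ->
  (forall q, Q q -> cont_sn (@S i) (@P i) (fun v => q (coord_inj v))) ->
  dual T Q f -> dual (@S i) (@P i) (fun v => f (coord_inj v)).
Proof.
move=> hQ hT cQ [f0 [lf cf]]; split; [|split].
- by move=> v Sv; apply: f0 => /hT.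
- by move=> a v w /hT Tv /hT Tw; rewrite coord_inj_linear lf.
- apply: (cont_sn_comp (@hP i) hQ (T := @coord_inj i)) cf => //.
  by move=> v /hT.
Qed.

Lemma dsum_dual_coord i f : dual (dsum_S S) (dsum_P S P) f ->
  dual (@S i) (@P i) (fun v => f (coord_inj v)).
Proof.
apply: dual_coord_inj; first by move=> p [].
  move=> v; split=> [|/dsum_sub_prod/(_ i)]; first exact: coord_inj_dsum.
  by rewrite coord_inj_in.
by move=> q /dsum_PP[_]; exact.
Qed.

Lemma prod_dual_coord i f : dual (prod_S S) (prod_P P) f ->
  dual (@S i) (@P i) (fun v => f (coord_inj v)).
Proof.
apply: dual_coord_inj; first exact: prod_seminorm.
  move=> v; split=> [Sv j|/(_ i)]; first exact: coord_inj_S.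
  by rewrite coord_inj_in.
by move=> _ [j [p Pp ->]]; exact: cont_sn_coord_inj.
Qed.

(** The envelope of a sequence in one member is finite, by finite support, and continuous along
    every summand, by coordinatewise equicontinuity; it is therefore itself a generator. *)
Lemma dsum_class_G : (forall i, class_G (@S i) (@P i)) ->
  class_G (dsum_S S) (dsum_P S P).
Proof.
move=> /dep_choice[A hA]; have Am i := (hA i).2.1.
have Ac i := (hA i).2.2.1; have Ae i := (hA i).2.2.2.
exists (fun a => [set f | dual (dsum_S S) (dsum_P S P) f /\
  forall i, A i (split_index a i) (fun v => f (coord_inj v))]).
split; [by move=> a f []|split; [|split]].
- move=> a b ab f [df hf]; split=> // i; apply: Am (hf i); exact: split_index_le.
- move=> f df; have /choice[b hb] i := Ac i _ (dsum_dual_coord i df).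
  have [a _ ha] := join_index 0 b; exists a; split=> // i; rewrite ha; exact: hb.
- move=> a u hu.
  have du n : dual (dsum_S S) (dsum_P S P) (u n) by have [] := hu n.
  have lu n := dual_linear (du n).
  have /dep_choice[q hq] i : exists q : V i -> R, cont_sn (@S i) (@P i) q /\
      forall n v, S v -> `|u n (coord_inj v)| <= q v.
    have /equicontinuousP[q cq h] := Ae i _ _ (fun n => (hu n).2 i).
    exists q; split=> // n v Sv.
    exact: (h (fun v => u n (coord_inj v)) v (ex_intro2 _ _ n Logic.I erefl) Sv).
  pose Q x := sup [set `|u n x| | n in [set: nat]].
  have bnd x : dsum_S S x -> exists M, forall n, [set: nat] n -> `|u n x| <= M.
    move=> Sx; have /dsum_SP[_ [N hN]] := Sx.
    exists (\sum_(i <- indices_below N) q i (x i)) => n _.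
    apply: le_trans (dsum_seminorm_le (seminorm_abs dsum_subspace (lu n)) Sx hN) _.
    by apply: ler_sum => i _; apply: (hq i).2; exact: dsum_sub_prod Sx i.
  apply/equicontinuousP; exists Q; last first.
    move=> _ x [n _ <-] Sx; have [M hM] := bnd _ Sx.
    exact: (@le_seminorm_sup _ _ _ _ (fun n x => `|u n x|) M).
  apply: cont_sn_mem; apply/dsum_PP; split.
    apply: (seminorm_sup dsum_subspace (q := fun n x => `|u n x|)) => // n _.
    exact: seminorm_abs dsum_subspace (lu n).
  move=> i; apply: cont_sn_le (hq i).1 => v Sv.
  apply: sup_ler; last by move=> _ [n _ <-]; exact: (hq i).2.
  exact: le_trans (normr_ge0 _) ((hq i).2 0%N v Sv).
Qed.

(** A continuous functional on a product sees finitely many coordinates only. Recording a bound for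
    them in [a 0] gives all terms of a sequence in one member the same finite set of coordinates,
    over which the estimates are summed. *)
Lemma prod_class_G : (forall i, class_G (@S i) (@P i)) ->
  class_G (prod_S S) (prod_P P).
Proof.
move=> /dep_choice[A hA]; have Am i := (hA i).2.1.
have Ac i := (hA i).2.2.1; have Ae i := (hA i).2.2.2.
pose low n (f : dprod V -> R) := forall x, prod_S S x ->
  (forall i, (pickle i < n)%N -> x i = 0) -> f x = 0.
exists (fun a => [set f | dual (prod_S S) (prod_P P) f /\ low (a 0%N) f /\
  forall i, A i (split_index a i) (fun v => f (coord_inj v))]).
split; [by move=> a f []|split; [|split]].
- move=> a b ab f [df [nf hf]]; split=> //; split.
    move=> x Sx x0; apply: nf => // i hi; apply: x0; exact: leq_trans hi (ab _).
  by move=> i; apply: Am (hf i); exact: split_index_le.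
- move=> f df; have /choice[b hb] i := Ac i _ (prod_dual_coord i df).
  have [n nf] : exists n, low n f.
    have [F [C [hF h]]] := dual_cont df.
    (* Each generator in [F] reads a single coordinate, so their sum vanishes once those coordinates
       do. *)
    suff [n hn] : exists n, forall x, prod_S S x ->
        (forall i, (pickle i < n)%N -> x i = 0) -> \sum_(p <- F) p x = 0.
      exists n => x Sx x0; apply/eqP; rewrite -normr_le0.
      by apply: le_trans (h _ Sx) _; rewrite hn // mulr0.
    elim: F hF {h} => [|p F IH] hF; first by exists 0%N => x _ _; rewrite big_nil.
    have [|n hn] := IH; first by move=> r rF; apply: hF; rewrite inE rF orbT.
    have [i [r Pr pE]] := hF p (mem_head _ _).
    exists (maxn n (pickle i).+1) => x Sx x0; rewrite big_cons hn // ?addr0; last first.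
      by move=> j hj; apply: x0; lia.
    by rewrite pE x0 ?(seminorm_on0 (hS i) (hP Pr)) //; lia.
  have [a a0 ha] := join_index n b; exists a; split=> //; split; first by rewrite a0.
  by move=> i; rewrite ha; exact: hb.
- move=> a u hu.
  have du n : dual (prod_S S) (prod_P P) (u n) by have [] := hu n.
  have lu n := dual_linear (du n).
  have nu n : low (a 0%N) (u n) by have [_ []] := hu n.
  have /dep_choice[q hq] i : exists q : V i -> R, cont_sn (@S i) (@P i) q /\
      forall n v, S v -> `|u n (coord_inj v)| <= q v.
    have /equicontinuousP[q cq h] := Ae i _ _ (fun n => (hu n).2.2 i).
    exists q; split=> // n v Sv.
    exact: (h (fun v => u n (coord_inj v)) v (ex_intro2 _ _ n Logic.I erefl) Sv).
  pose s : seq I := indices_below (a 0%N).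
  apply/equicontinuousP; exists (fun x => \sum_(i <- s) q i (x i)).
    apply: (cont_sn_sum prod_seminorm (q := fun i x => q i (x i))) => i _.
    apply: (cont_sn_comp prod_seminorm (@hP i) (T := fun x : dprod V => x i)) (hq i).1.
      by move=> x; exact.
    by move=> p Pp; apply: cont_sn_mem; exists i, p.
  move=> _ x [n _ <-] Sx.
  have Sy i : prod_S S (coord_inj (x i)) by move=> j; apply: coord_inj_S; exact: Sx.
  have Sys : prod_S S (\sum_(i <- s) coord_inj (x i)).
    exact: subspace_sum prod_subspace Sy.
  (* The truncation agrees with [x] on all coordinates of code below [a 0], and [nu] kills the
     difference. *)
  have -> : u n x = u n (\sum_(i <- s) coord_inj (x i)).
    apply/eqP; rewrite -subr_eq0 -(linear_onB (lu n)) //; apply/eqP; apply: nu.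
      exact: subspaceB prod_subspace Sx Sys.
    by move=> i hi; rewrite dprod_subE sum_coord_inj // subrr.
  apply: le_trans (seminorm_le_sum s prod_subspace
    (seminorm_abs prod_subspace (lu n)) Sy) _.
  by apply: ler_sum => i _; apply: (hq i).2; exact: Sx.
Qed.

End Spaces.
End DirectProducts.

(** * Subspaces *)

Section Subspaces.
Context {R : realType} {V : lmodType R}.
Variables (S T : set V) (P : set (V -> R)).
Hypotheses (TS : T `<=` S) (hT : linear_subspace T).

Lemma seminorm_sub (p : V -> R) : seminorm_on S p -> seminorm_on T p.
Proof.
move=> [p0 [pD pZ]]; split; first by move=> x /TS; exact: p0.
by split=> [x y /TS Sx /TS|a x /TS]; [exact: pD|exact: pZ].
Qed.

Lemma subspace_lcs : lcs S P -> lcs T P.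
Proof.
move=> [_ [hP sep]]; split=> //; split; first by move=> p /hP/seminorm_sub.
by move=> x /TS; exact: sep.
Qed.

Lemma subspace_bounded_resolution :
  fundamental_bounded_resolution S P -> fundamental_bounded_resolution T P.
Proof.
move=> [A [Ab [Am [Ac Af]]]]; exists (fun a => A a `&` T); split; [|split; [|split]].
- move=> a; split=> [x []//|p /(Ab a).2[M hM]]; exists M => x [Ax _]; exact: hM.
- by move=> a b ab x [Ax Tx]; split=> //; exact: Am Ax.
- by move=> x Tx; have [a Ax] := Ac _ (TS Tx); exists a.
- move=> B [BT hB]; have [|a Ba] := Af B; first by split=> // x /BT/TS.
  by exists a => x Bx; split; [exact: Ba|exact: BT].
Qed.

Lemma subspace_dual_extension (f : V -> R) : lcs S P -> dual T P f ->
  exists2 g, dual S P g & forall x, T x -> f x = g x.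
Proof.
move=> [hS [hP _]] df.
have hPT p : P p -> seminorm_on T p by move=> /hP/seminorm_sub.
have [F [C [C0 [hF h]]]] := cont_sn_ge0 hPT (dual_cont df).
have [s0 [sD sZ]] : seminorm_on S (fun x => \sum_(p <- F) p x).
  by apply: seminorm_sum => p /hF/hP.
have hs : seminorm_on S (fun x => C * \sum_(p <- F) p x).
  split=> [x Sx|]; first by rewrite mulr_ge0 ?s0.
  split=> [x y Sx Sy|a x Sx]; last by rewrite sZ // mulrCA.
  by rewrite -mulrDr ler_wpM2l ?sD.
have [g [lg g0 gs gf]] := hahn_banach hS hs hT TS (dual_linear df) h.
exists g => [|x /gf ->//]; split=> //; split=> //.
by exists F, C.
Qed.

(** The members consist of restrictions, which cover the dual of [T] by Hahn-Banach and inherit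
    equicontinuity from their extensions. Agreement is asked on [T] only, because functionals in
    [dual T P] vanish outside [T]. *)
Lemma subspace_class_G : lcs S P -> class_G S P -> class_G T P.
Proof.
move=> hE [A [AS [Am [Ac Ae]]]].
exists (fun a => [set f | dual T P f /\ exists2 g, A a g & forall x, T x -> f x = g x]).
split; [by move=> a f []|split; [|split]].
- by move=> a b ab f [df [g Ag fg]]; split=> //; exists g => //; exact: Am Ag.
- move=> f df; have [g dg fg] := subspace_dual_extension hE df.
  by have [a Ag] := Ac _ dg; exists a; split=> //; exists g.
- move=> a u hu.
  have /choice[g hg] n : exists g, A a g /\ forall x, T x -> u n x = g x.
    by have [_ [g ? ?]] := hu n; exists g.
  have [F [C [hF h]]] := Ae a g (fun n => (hg n).1).
  exists F, C; split=> // _ x [n _ <-] Tx; rewrite (hg n).2 //.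
  by apply: h; [exists n|exact: TS].
Qed.

End Subspaces.

Theorem theorem4p1 (R : realType) :
  (* (i) *)
  ((forall (V : lmodType R) (S : set V) (P : set (V -> R)),
      lcs S P -> regular_LM S P -> quasi_DF S P) /\
   (forall (V : lmodType R) (S : set V) (P : set (V -> R)),
      lcs S P -> metrizable_subset P S -> infinite_dimensional S ->
      ~ normable S P -> quasi_DF S P /\ ~ DF S P)) /\
  (* (ii) *)
  (forall (V : lmodType R) (S : set V) (P : set (V -> R)),
      lcs S P -> regular_LM S P ->
      @quasi_DF R (V -> R^o) (dual S P) (strong_dual_sn S P)) /\
  (* (iii) *)
  (forall (I : countType) (V : I -> lmodType R) (S : forall i, set (V i))
      (P : forall i, set (V i -> R)),
      (forall i, quasi_DF (S i) (P i)) -> quasi_DF (dsum_S S) (dsum_P S P)) /\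
  (* (iv) *)
  (forall (V : lmodType R) (S T : set V) (P : set (V -> R)),
      quasi_DF S P -> T `<=` S -> linear_subspace T -> quasi_DF T P) /\
  (* (v) *)
  (forall (I : countType) (V : I -> lmodType R) (S : forall i, set (V i))
      (P : forall i, set (V i -> R)),
      (forall i, quasi_DF (S i) (P i)) -> quasi_DF (prod_S S) (prod_P P)) /\
  (* (vi) *)
  (forall (V : lmodType R) (S B : set V) (P : set (V -> R)),
      quasi_DF S P -> precompact S P B -> metrizable_subset P B).
Proof.
split; [split|split; [|split; [|split; [|split]]]].
- by move=> V S P; exact: regular_LM_quasi_DF.
- move=> V S P hE hm _ nn; split.
    exact: regular_LM_quasi_DF hE (metrizable_regular_LM hE hm).
  by move=> /(metrizable_DF_normable hE hm).
- by move=> V S P; exact: strong_dual_quasi_DF.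
- move=> I V S P h; have hE i := (h i).1; split; first exact: dsum_lcs.
  split; first by apply: dsum_bounded_resolution => // i; exact: (h i).2.1.
  by apply: dsum_class_G => // i; exact: (h i).2.2.
- move=> V S T P [hE [hb hG]] TS hT; split; first exact: subspace_lcs hE.
  by split; [exact: subspace_bounded_resolution hb|exact: subspace_class_G hG].
- move=> I V S P h; have hE i := (h i).1; split; first exact: prod_lcs.
  split; first by apply: prod_bounded_resolution => i; exact: (h i).2.1.
  by apply: prod_class_G => // i; exact: (h i).2.2.
- by move=> V S B P [hE [_ hG]]; exact: class_G_precompact_metrizable.
Qed.
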